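(* A connected Kähler surface $(M,g,J)$ is a QCH manifold if and only if it admits a negative almost complex structure $\overline{J}$ satisfying the second Gray condition of the curvature, i.e. $$R(X,Y,Z,W)-R(\overline{J}X,\overline{J}Y,Z,W)=R(\overline{J}X,Y,\overline{J}Z,W)+R(\overline{J}X,Y,Z,\overline{J}W)$$ for all vector fields $X,Y,Z,W$. The $J$-invariant distribution $\mathcal{D}$ with respect to which $(M,g,J)$ is a QCH manifold is given by $\mathcal{D}=\ker(J\overline{J}-\mathrm{Id})$ or by $\mathcal{D}=\ker(J\overline{J}+\mathrm{Id})$.
   Context: A Kähler surface is a Kähler manifold $(M,g,J)$ of real dimension $4$, oriented by $J$. A negative almost complex structure $\overline{J}$ on $(M,g,J)$ is a $g$-orthogonal almost complex structure inducing the opposite orientation. The curvature tensor is $R(X,Y)Z=([\nabla_X,\nabla_Y]-\nabla_{[X,Y]})Z$, $R(X,Y,Z,W)=g(R(X,Y)Z,W)$. A connected Kähler surface $(M,g,J)$ is a QCH manifold with respect to a global smooth $J$-invariant $2$-dimensional distribution $\mathcal{D}\subset TM$ if, for every $x\in M$ and every unit vector $X\in T_xM$, the holomorphic sectional curvature $R(X,JX,JX,X)$ depends only on $x$ and on $|X_{\mathcal{D}}|$, where $X_{\mathcal{D}}$ is the orthogonal projection of $X$ on $\mathcal{D}$. It is a QCH manifold if it is so with respect to some such $\mathcal{D}$. The last sentence of the claim means: if $\overline{J}$ is a negative almost complex structure satisfying the displayed condition, then distributions with respect to which $(M,g,J)$ is QCH are given by either of the two kernels. *)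

(* Defs.v *)
From HB Require Import structures.
From mathcomp Require Import all_boot all_order all_algebra.
From mathcomp Require Import all_classical all_reals all_analysis.

Set Implicit Arguments.
Unset Strict Implicit.
Unset Printing Implicit Defensive.

Import Order.TTheory GRing.Theory Num.Theory numFieldNormedType.Exports.
Local Open Scope classical_set_scope.
Local Open Scope ring_scope.

(* Vectors are rows: a matrix A acts as the endomorphism v |-> v *m A, so the  *)
(* composite A o B has matrix B *m A, the kernel of A is the row space of      *)
(* kermx A, and the differential of a map f at y is v |-> v *m 'J f y.         *)

(* U is meant to be open *)
Fixpoint Ck (R : realType) (V W : normedModType R) (k : nat) (U : set V)
    (f : V -> W) : Prop :=
  match k with
  | 0 => forall x, U x -> {for x, continuous f}
  | k'.+1 => (forall x, U x -> differentiable f x) /\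
             (forall v, Ck k' U ('D_v f))
  end.

Definition smooth_on (R : realType) (V W : normedModType R) (U : set V)
    (f : V -> W) : Prop := forall k, Ck k U f.

Record chart (R : realType) (n : nat) (M : topologicalType) := Chart {
  dom : set M;
  coord : M -> 'rV[R]_n;
  param : 'rV[R]_n -> M;
  dom_open : open dom;
  codom_open : open (coord @` dom);
  coordK : forall x, dom x -> param (coord x) = x;
  coord_continuous : {within dom, continuous coord};
  param_continuous : {within coord @` dom, continuous param}
}.

Definition chart_codom (R : realType) (n : nat) (M : topologicalType)
    (c : chart R n M) : set 'rV[R]_n := coord c @` dom c.

Definition overlap (R : realType) (n : nat) (M : topologicalType)
    (c d : chart R n M) : set 'rV[R]_n := coord c @` (dom c `&` dom d).

Definition transition (R : realType) (n : nat) (M : topologicalType)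
    (c d : chart R n M) : 'rV[R]_n -> 'rV[R]_n := coord d \o param c.

Record manifold (R : realType) (n : nat) := Manifold {
  points :> topologicalType;
  index : Type;
  atlas : index -> chart R n points;
  atlas_cover : forall x : points, exists c, dom (atlas c) x;
  atlas_smooth : forall c d, smooth_on (overlap (atlas c) (atlas d))
                                       (transition (atlas c) (atlas d));
  manifold_hausdorff : hausdorff_space points;
  manifold_second_countable : @second_countable points
}.

(* Components, in every chart and as functions of the coordinates, of a       *)
(* (0,2)-tensor, of an endomorphism of TM, or of a distribution (whose fibre   *)
(* is the row space). Values outside chart_codom are irrelevant. A tangent    *)
(* vector at the point of coordinates y is given by its row of components;    *)
(* its components in another chart are obtained by applying the Jacobian.     *)
Definition components (R : realType) (n : nat) (M : manifold R n) : Type :=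
  index M -> 'rV[R]_n -> 'M[R]_n.

Definition smooth_components (R : realType) (n : nat) (M : manifold R n)
    (T : components M) : Prop :=
  forall c, smooth_on (chart_codom (atlas c)) (T c).

Definition is_form (R : realType) (n : nat) (M : manifold R n)
    (g : components M) : Prop :=
  forall c d y, overlap (atlas c) (atlas d) y ->
    let A := 'J (transition (atlas c) (atlas d)) y in
    g c y = A *m g d (transition (atlas c) (atlas d) y) *m A^T.

Definition is_endomorphism (R : realType) (n : nat) (M : manifold R n)
    (F : components M) : Prop :=
  forall c d y, overlap (atlas c) (atlas d) y ->
    let A := 'J (transition (atlas c) (atlas d)) y in
    F c y *m A = A *m F d (transition (atlas c) (atlas d) y).

Definition is_subbundle (R : realType) (n : nat) (M : manifold R n)
    (D : components M) : Prop :=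
  forall c d y, overlap (atlas c) (atlas d) y ->
    let A := 'J (transition (atlas c) (atlas d)) y in
    (D c y *m A == D d (transition (atlas c) (atlas d) y))%MS.

Definition inner (R : realType) (n : nat) (G : 'M[R]_n) (u v : 'rV[R]_n) : R :=
  (u *m G *m v^T) 0 0.

Definition gnorm (R : realType) (n : nat) (G : 'M[R]_n) (u : 'rV[R]_n) : R :=
  Num.sqrt (inner G u u).

Definition riemannian_metric (R : realType) (n : nat) (M : manifold R n)
    (g : components M) : Prop :=
  [/\ smooth_components g,
      is_form g,
      forall c y, chart_codom (atlas c) y -> (g c y)^T = g c y &
      forall c y u, chart_codom (atlas c) y -> u != 0 -> 0 < inner (g c y) u u].

(* Below, G is the matrix of a metric as a function of the coordinates.        *)

(* Nabla_u v for vector fields with constant components, by Koszul's formula   *)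
(* 2 G(Nabla_u v, w) = D_u G(v, w) + D_v G(u, w) - D_w G(u, v).                *)
Definition christoffel (R : realType) (n : nat) (G : 'rV[R]_n -> 'M[R]_n)
    (y u v : 'rV[R]_n) : 'rV[R]_n :=
  2^-1 *: (\row_k (inner ('D_u G y) v 'e_k + inner ('D_v G y) u 'e_k
                   - inner ('D_('e_k) G y) u v)) *m invmx (G y).

(* Levi-Civita connection on vector fields X, Y in coordinates *)
Definition nabla (R : realType) (n : nat) (G : 'rV[R]_n -> 'M[R]_n)
    (X Y : 'rV[R]_n -> 'rV[R]_n) : 'rV[R]_n -> 'rV[R]_n :=
  fun y => 'D_(X y) Y y + christoffel G y (X y) (Y y).

Definition lie_bracket (R : realType) (n : nat)
    (X Y : 'rV[R]_n -> 'rV[R]_n) : 'rV[R]_n -> 'rV[R]_n :=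
  fun y => 'D_(X y) Y y - 'D_(Y y) X y.

Definition curvature (R : realType) (n : nat) (G : 'rV[R]_n -> 'M[R]_n)
    (X Y Z : 'rV[R]_n -> 'rV[R]_n) : 'rV[R]_n -> 'rV[R]_n :=
  fun y => nabla G X (nabla G Y Z) y - nabla G Y (nabla G X Z) y
           - nabla G (lie_bracket X Y) Z y.

(* R(u, v, w, z) for tangent vectors at y. The curvature is tensorial, so any  *)
(* extensions of u, v, w to vector fields may be used: take the ones with      *)
(* constant components.                                                       *)
Definition Riem (R : realType) (n : nat) (G : 'rV[R]_n -> 'M[R]_n)
    (y u v w z : 'rV[R]_n) : R :=
  inner (G y) (curvature G (cst u) (cst v) (cst w) y) z.

Definition orthogonal_acs (R : realType) (n : nat) (M : manifold R n)
    (g J : components M) : Prop :=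
  [/\ smooth_components J,
      is_endomorphism J,
      forall c y, chart_codom (atlas c) y -> J c y *m J c y = - 1%:M &
      forall c y u v, chart_codom (atlas c) y ->
        inner (g c y) (u *m J c y) (v *m J c y) = inner (g c y) u v].

(* Nabla (J Y) = J (Nabla Y) for all local vector fields Y *)
Definition parallel (R : realType) (n : nat) (M : manifold R n)
    (g J : components M) : Prop :=
  forall c y (X Y : 'rV[R]_n -> 'rV[R]_n), chart_codom (atlas c) y ->
    smooth_on (chart_codom (atlas c)) X -> smooth_on (chart_codom (atlas c)) Y ->
    nabla (g c) X (fun z => Y z *m J c z) y = nabla (g c) X Y y *m J c y.

Definition kahler (R : realType) (n : nat) (M : manifold R n)
    (g J : components M) : Prop :=
  [/\ riemannian_metric g, orthogonal_acs g J & parallel g J].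

Definition complex_frame (R : realType) (J : 'M[R]_4) (u v : 'rV[R]_4) :
    'M[R]_4 :=
  col_mx (col_mx u (u *m J)) (col_mx v (v *m J)).

(* The orientation induced by J is that of the bases (u, J u, v, J v).         *)
Definition opposite_orientation (R : realType) (J K : 'M[R]_4) : Prop :=
  forall u v u' v' : 'rV[R]_4,
    \det (complex_frame J u v) != 0 -> \det (complex_frame K u' v') != 0 ->
    \det (complex_frame J u v) * \det (complex_frame K u' v') < 0.

Definition negative_acs (R : realType) (M : manifold R 4)
    (g J K : components M) : Prop :=
  orthogonal_acs g K /\
  forall c y, chart_codom (atlas c) y -> opposite_orientation (J c y) (K c y).

Definition second_gray_condition (R : realType) (n : nat) (M : manifold R n)
    (g K : components M) : Prop :=
  forall c y (X Y Z W : 'rV[R]_n), chart_codom (atlas c) y ->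
    let Rm := Riem (g c) y in
    let k (v : 'rV[R]_n) := v *m K c y in
    Rm X Y Z W - Rm (k X) (k Y) Z W = Rm (k X) Y (k Z) W + Rm (k X) Y Z (k W).

Definition smooth_distribution (R : realType) (n k : nat) (M : manifold R n)
    (D : components M) : Prop :=
  [/\ is_subbundle D,
      forall c y, chart_codom (atlas c) y -> \rank (D c y) = k &
      forall c y, chart_codom (atlas c) y ->
        exists (U : set 'rV[R]_n) (E : 'rV[R]_n -> 'M[R]_(k, n)),
          [/\ open U, U y, U `<=` chart_codom (atlas c), smooth_on U E &
              forall z, U z -> (E z == D c z)%MS]].

Definition invariant_distribution (R : realType) (n : nat) (M : manifold R n)
    (J D : components M) : Prop :=
  forall c y, chart_codom (atlas c) y -> stablemx (D c y) (J c y).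

Definition orthogonal_complement (R : realType) (n : nat) (G D : 'M[R]_n) :
    'M[R]_n := kermx (G *m D^T).

Definition orthogonal_projection (R : realType) (n : nat) (G D : 'M[R]_n)
    (u : 'rV[R]_n) : 'rV[R]_n := u *m proj_mx D (orthogonal_complement G D).

Definition holomorphic_curvature (R : realType) (n : nat) (M : manifold R n)
    (g J : components M) (c : index M) (y u : 'rV[R]_n) : R :=
  Riem (g c) y u (u *m J c y) (u *m J c y) u.

Definition QCH_wrt (R : realType) (M : manifold R 4)
    (g J D : components M) : Prop :=
  [/\ smooth_distribution 2 D,
      invariant_distribution J D &
      forall c y (u v : 'rV[R]_4), chart_codom (atlas c) y ->
        gnorm (g c y) u = 1 -> gnorm (g c y) v = 1 ->
        gnorm (g c y) (orthogonal_projection (g c y) (D c y) u) =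
        gnorm (g c y) (orthogonal_projection (g c y) (D c y) v) ->
        holomorphic_curvature g J c y u = holomorphic_curvature g J c y v].

Definition QCH (R : realType) (M : manifold R 4) (g J : components M) : Prop :=
  exists D : components M, QCH_wrt g J D.

(* ker (J o K - Id) and ker (J o K + Id) *)
Definition ker_sub (R : realType) (n : nat) (M : manifold R n)
    (J K : components M) : components M :=
  fun c y => kermx (K c y *m J c y - 1%:M).

Definition ker_add (R : realType) (n : nat) (M : manifold R n)
    (J K : components M) : components M :=
  fun c y => kermx (K c y *m J c y + 1%:M).

(* Main.v *)
Require Import Defs.
From mathcomp Require Import all_boot all_order all_algebra.
From mathcomp Require Import all_classical all_reals all_analysis.
From mathcomp Require Import ring lra.

Set Implicit Arguments.
Unset Strict Implicit.
Unset Printing Implicit Defensive.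

Import Order.TTheory GRing.Theory Num.Theory numFieldNormedType.Exports.
Local Open Scope classical_set_scope.
Local Open Scope ring_scope.

(** The statement is pointwise linear algebra plus smoothness.

    At a point, let D and its orthogonal complement be two J-stable planes,
    with unit vectors e in D and f in the complement, so that e, Je, f, Jf is
    an orthonormal basis. A curvature tensor of Kaehler type sees a pair X, Y
    only through four numbers p, q, r, s (the e-Je and f-Jf components of the
    bivector X /\ Y, and two combinations of the mixed ones, [Rm_pair]); it is
    a symmetric bilinear form in these numbers ([Rm_lin4]). For X a vector and
    Y = JX one has p = |X_D|^2, q = |X - X_D|^2, and (r, s) is an arbitrary
    vector with r^2 + s^2 = 4 p q. Hence the holomorphic sectional curvature of
    unit vectors depends only on |X_D| if and only if the form is invariant
    under rotations of (r, s): six linear equations ([circle_invariant],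
    [hol_depends_onP]). The second Gray condition for the structure K equal to
    J on D and to -J on the complement is the same six equations
    ([circle_invariant_gray], [gray_circle_invariant]), and it does not
    distinguish K from -K ([gray_scale]).

    Planes D and structures K correspond to each other. From D one builds K
    ([reflected]), which has the opposite orientation. Conversely an orthogonal
    complex structure K of opposite orientation commutes with J
    ([opposite_commute]), so that KJ is a self-adjoint involution; its two
    eigenspaces are J-stable, nonzero because K is neither J nor -J, hence
    planes, and K is -J on one and J on the other ([ker_rank], [ker_mulK]).

    It remains to know that the coordinate expression [Riem] is a curvature
    tensor of Kaehler type. Differentiating once more the equations saying
    that the metric and J are parallel, and using that second derivatives
    commute ([schwarz_mx]), gives the antisymmetry of the curvature in its last
    two arguments and its commutation with J ([curvature_mx_skew],
    [curvature_mx_parallel]). Smoothness of K follows from the Gram formula for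
    the projection on D in a local frame ([proj_frame]); a local frame of an
    eigenspace of KJ is obtained by projecting a fixed basis of the eigenspace
    at one point ([ker_local_frame]).

    Vectors being rows, u *m K *m J is J applied to Ku. *)

(** * Functions of class C^k *)

Section Smoothness.
Context (R : realType) (V : normedModType R).
Implicit Types (U : set V) (k : nat).

(** Lets a smooth object be constructed from local frames. *)
Lemma Ck_local (W : normedModType R) k U (f : V -> W) :
  (forall x, U x -> exists2 U', U' x & Ck k U' f) -> Ck k U f.
Proof.
elim: k f => [|k IH] f H /=.
  by move=> x /H[U' U'x]; apply.
split=> [x /H[U' U'x [df _]]|v]; first exact: df.
by apply: IH => x /H[U' U'x [_ ck]]; exists U' => //; exact: ck.
Qed.

Lemma Ck_subset (W : normedModType R) k U U' (f : V -> W) :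
  U' `<=` U -> Ck k U f -> Ck k U' f.
Proof. by move=> sU ckf; apply: Ck_local => x /sU Ux; exists U. Qed.

Lemma differentiable_near0 (W : normedModType R) (h : V -> W) (x : V) :
  (\forall z \near x, h z = 0) -> differentiable h x.
Proof.
move=> h0; have hx : h x = 0 by exact: (nbhs_singleton h0).
have E : h \o shift x = cst (h x) + (\0 : V -> W) +o_ 0 id.
  apply/eqaddoP => _/posnumP[e]; rewrite hx.
  have : \forall z \near 0, h (z + x) = 0.
    by move: h0; rewrite (near_shift 0 x) /= subr0.
  apply: filterS => z hz.
  rewrite /= fctE /= hz /cst /= !fctE /= addr0 subrr normr0.
  by rewrite mulr_ge0.
have c0 : continuous (\0 : V -> W) by exact: cst_continuous.
have d0 := @diff_unique _ _ _ h \0 x c0 E.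
by apply/diff_locallyP; rewrite d0; split.
Qed.

Lemma near_eq_differentiable (W : normedModType R) (f g : V -> W) (x : V) :
  (\forall z \near x, f z = g z) -> differentiable f x -> differentiable g x.
Proof.
move=> fg df; rewrite (_ : g = f + (g - f)); last first.
  by apply/funext => z; rewrite !fctE addrC subrK.
apply: differentiableD => //; apply: differentiable_near0.
by apply: filterS fg => z; rewrite !fctE => ->; rewrite subrr.
Qed.

(** The functions to be studied are only controlled on U, so derivatives of
    sums and products are computed there and transported by this lemma. *)
Lemma Ck_eq (W : normedModType R) k U (f g : V -> W) :
  open U -> (forall x, U x -> f x = g x) -> Ck k U f -> Ck k U g.
Proof.
move=> oU; elim: k f g => [|k IH] f g fg /=.
  move=> cf x Ux; have fgx : \forall z \near x, f z = g z.
    by apply: filterS (open_nbhs_nbhs (conj oU Ux)) => z; exact: fg.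
  have : f @ x --> f x := cf x Ux; rewrite (fg x Ux) => cfx.
  apply: cvg_trans cfx; apply: near_eq_cvg; exact: fgx.
have nfg x : U x -> \forall z \near x, f z = g z.
  by move=> Ux; apply: filterS (open_nbhs_nbhs (conj oU Ux)) => z; exact: fg.
move=> [df ckf]; split=> [x Ux|v].
  exact: near_eq_differentiable (nfg x Ux) (df x Ux).
by apply: IH (ckf v) => x Ux; exact: near_eq_derive (nfg x Ux).
Qed.

Lemma Ck_weaken (W : normedModType R) k U (f : V -> W) :
  Ck k.+1 U f -> Ck k U f.
Proof.
elim: k f => [|k IH] f [df ckf].
  by move=> x Ux; exact: differentiable_continuous (df x Ux).
by split=> // v; apply: IH.
Qed.

Lemma Ck_cst (W : normedModType R) k U (a : W) : Ck k U (cst a : V -> W).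
Proof.
elim: k a => [|k IH] a /=; first by move=> x _; exact: cst_continuous.
split=> [x _|v]; first exact: differentiable_cst.
rewrite (_ : 'D_v (cst a) = cst 0); first exact: IH.
by apply/funext => x; rewrite derive_cst.
Qed.

Lemma Ck_add (W : normedModType R) k U (f g : V -> W) : open U ->
  Ck k U f -> Ck k U g -> Ck k U (fun x => f x + g x).
Proof.
move=> oU; elim: k f g => [|k IH] f g /=.
  by move=> cf cg x Ux; apply: cvgD; [exact: cf|exact: cg].
move=> [df ckf] [dg ckg]; split=> [x Ux|v].
  by apply: differentiableD; [exact: df|exact: dg].
apply: (@Ck_eq _ _ _ (fun x => 'D_v f x + 'D_v g x)) => // [x Ux|].
  by rewrite -deriveD//; apply: diff_derivable; [exact: df|exact: dg].
exact: IH.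
Qed.

(** Induction on k through the Leibniz rule, whose terms involve the functions
    themselves, hence the use of [Ck_weaken]. *)
Lemma Ck_mul k U (f g : V -> R) : open U ->
  Ck k U f -> Ck k U g -> Ck k U (fun x => f x * g x).
Proof.
move=> oU; elim: k f g => [|k IH] f g ckf ckg.
  by move=> x Ux; apply: cvgM; [exact: ckf|exact: ckg].
have [ckf' ckg'] := (Ck_weaken ckf, Ck_weaken ckg).
case: ckf ckg => [df ckf] [dg ckg]; split=> [x Ux|v].
  by apply: differentiableM; [exact: df|exact: dg].
apply: (@Ck_eq _ _ _ (fun x => f x * 'D_v g x + g x * 'D_v f x)) => // [x Ux|].
  by rewrite (@deriveM _ _ f g)//; apply: diff_derivable; [exact: df|exact: dg].
by apply: Ck_add => //; apply: IH => //; [exact: ckg|exact: ckf].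
Qed.

(** The derivative of 1 / f is - f' / f^2, to which the induction hypothesis
    applies twice. *)
Lemma Ck_inv k U (f : V -> R) : open U -> (forall x, U x -> f x != 0) ->
  Ck k U f -> Ck k U (fun x => (f x)^-1).
Proof.
move=> oU f0; elim: k => [|k IH] ckf.
  by move=> x Ux; apply: cvgV; [exact: f0|exact: ckf].
have ckf' := Ck_weaken ckf; case: ckf => [df ckf]; split=> [x Ux|v].
  by apply: differentiableV; [exact: df|exact: f0].
pose h x := (-1) * ((f x)^-1 * (f x)^-1 * 'D_v f x).
apply: (@Ck_eq _ _ _ h) => // [x Ux|].
  rewrite (@deriveV _ _ f x v)//; [|exact: f0|exact/diff_derivable/df].
  by rewrite /h mulN1r -scaleNr /GRing.scale /= -exprVn expr2 mulNr.
apply: Ck_mul => //; first exact: Ck_cst.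
by apply: Ck_mul (ckf v) => //; apply: Ck_mul => //; apply: IH.
Qed.

Lemma Ck_sum (I : Type) (r : seq I) (P : pred I) (W : normedModType R)
    k U (F : I -> V -> W) : open U ->
  (forall i, P i -> Ck k U (F i)) -> Ck k U (fun x => \sum_(i <- r | P i) F i x).
Proof.
move=> oU ckF; elim: r => [|i r IH].
  by rewrite (_ : (fun _ => _) = cst 0);
    [exact: Ck_cst|apply/funext => x; rewrite big_nil].
rewrite (_ : (fun _ => _) = fun x => (if P i then F i x else 0) +
    \sum_(j <- r | P j) F j x); last first.
  by apply/funext => x; rewrite big_cons; case: ifP; rewrite ?add0r.
apply: Ck_add => //; case: (boolP (P i)) => [/ckF//|_]; exact: Ck_cst.
Qed.

Lemma Ck_prod (I : Type) (r : seq I) (P : pred I) k U (F : I -> V -> R) :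
  open U -> (forall i, P i -> Ck k U (F i)) ->
  Ck k U (fun x => \prod_(i <- r | P i) F i x).
Proof.
move=> oU ckF; elim: r => [|i r IH].
  by rewrite (_ : (fun _ => _) = cst 1);
    [exact: Ck_cst|apply/funext => x; rewrite big_nil].
rewrite (_ : (fun _ => _) = fun x => (if P i then F i x else 1) *
    \prod_(j <- r | P j) F j x); last first.
  by apply/funext => x; rewrite big_cons; case: ifP; rewrite ?mul1r.
apply: Ck_mul => //; case: (boolP (P i)) => [/ckF//|_]; exact: Ck_cst.
Qed.

Lemma Ck_scalel (W : normedModType R) k U (f : V -> R) (a : W) : open U ->
  Ck k U f -> Ck k U (fun x => f x *: a).
Proof.
move=> oU; elim: k f => [|k IH] f.
  by move=> cf x Ux; apply: cvgZr_tmp; exact: cf.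
move=> [df ckf]; split=> [x Ux|v]; first exact/differentiableZl/df.
apply: (@Ck_eq _ _ _ (fun x => 'D_v f x *: a)) => // [x Ux|]; last exact: IH (ckf v).
have dfx := df x Ux.
rewrite (@deriveE _ _ _ (fun z => f z *: a)); last exact: differentiableZl.
by rewrite diffZl// -deriveE.
Qed.

Lemma Ck_mxP m n k U (A : V -> 'M[R]_(m, n)) : open U ->
  Ck k U A <-> forall i j, Ck k U (fun x => A x i j).
Proof.
move=> oU; split=> [ckA i j|ckA].
  elim: k A ckA => [|k IH] A.
    move=> cA x Ux.
    exact: (@continuous_comp _ _ _ A (fun M : 'M[R]_(m, n) => M i j) x (cA x Ux)
      (@coord_continuous _ _ _ _ _ _)).
  move=> [dA ckA]; split=> [x Ux|v].
    exact: (differentiable_comp (dA x Ux) (differentiable_coord _ _ _)).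
  apply: Ck_eq oU _ (IH _ (ckA v)) => x Ux.
  by rewrite derive_mx ?mxE//; exact/diff_derivable/dA.
rewrite (_ : A = fun x => \sum_i \sum_j A x i j *: delta_mx i j).
  by apply: Ck_sum => // i _; apply: Ck_sum => // j _; exact: Ck_scalel.
by apply/funext => x; rewrite {1}(matrix_sum_delta (A x)).
Qed.

Lemma Ck_trmx m n k U (A : V -> 'M[R]_(m, n)) : open U ->
  Ck k U A -> Ck k U (fun x => (A x)^T).
Proof.
move=> oU /(Ck_mxP _ _ oU) ckA; apply/Ck_mxP => // i j.
by rewrite (_ : (fun _ => _) = fun x => A x j i)//; apply/funext => x; rewrite mxE.
Qed.

Lemma Ck_mulmx m n p k U (A : V -> 'M[R]_(m, n)) (B : V -> 'M[R]_(n, p)) :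
  open U -> Ck k U A -> Ck k U B -> Ck k U (fun x => A x *m B x).
Proof.
move=> oU /(Ck_mxP _ _ oU) ckA /(Ck_mxP _ _ oU) ckB; apply/Ck_mxP => // i j.
rewrite (_ : (fun _ => _) = fun x => \sum_l A x i l * B x l j); last first.
  by apply/funext => x; rewrite mxE.
by apply: Ck_sum => // l _; exact: Ck_mul.
Qed.

Lemma Ck_det n k U (A : V -> 'M[R]_n) : open U ->
  Ck k U A -> Ck k U (fun x => \det (A x)).
Proof.
move=> oU /(Ck_mxP _ _ oU) ckA; apply: Ck_sum => // s _; apply: Ck_mul => //.
  exact: Ck_cst.
by apply: Ck_prod => // i _.
Qed.

(** Cramer's rule. *)
Lemma Ck_invmx n k U (A : V -> 'M[R]_n) : open U ->
  (forall x, U x -> A x \in unitmx) ->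
  Ck k U A -> Ck k U (fun x => invmx (A x)).
Proof.
move=> oU uA ckA.
apply: (@Ck_eq _ _ _ (fun x => (\det (A x))^-1 *: \adj (A x))) => //.
  by move=> x /uA; rewrite /invmx => ->.
apply/Ck_mxP => // i j.
rewrite (_ : (fun _ => _) = fun x => (\det (A x))^-1 *
    ((-1) ^+ (j + i) * \det (row' j (col' i (A x))))); last first.
  by apply/funext => x; rewrite !mxE.
apply: Ck_mul => //.
  by apply: Ck_inv (Ck_det _ ckA) => // x /uA; rewrite unitmxE unitfE.
apply: Ck_mul => //; first exact: Ck_cst.
apply: Ck_det => //; apply/Ck_mxP => // i' j'.
rewrite (_ : (fun _ => _) = fun x => A x (lift j i') (lift i j')); last first.
  by apply/funext => x; rewrite !mxE.
by move/Ck_mxP: ckA; apply.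
Qed.

(** The Leibniz rule for matrix products, from the one for the entries. *)
Lemma derive_mulmx m n p (A : V -> 'M[R]_(m, n)) (B : V -> 'M[R]_(n, p)) x v :
  derivable A x v -> derivable B x v ->
  'D_v (fun z => A z *m B z) x = 'D_v A x *m B x + A x *m 'D_v B x.
Proof.
move=> dA dB.
have dAB : forall i j, is_derive x v (fun z => (A z *m B z) i j)
    (('D_v A x *m B x + A x *m 'D_v B x) i j).
  move=> i j; rewrite (_ : (fun _ => _) =
     \sum_l ((fun z => A z i l) * (fun z => B z l j))); last first.
    apply/funext => z; rewrite mxE fct_sumE; exact: eq_bigr.
  rewrite (_ : fun_of_matrix _ i j = \sum_l (A x i l *: 'D_v (fun z => B z l j) x +
      B x l j *: 'D_v (fun z => A z i l) x)); last first.
    rewrite !mxE -big_split; apply: eq_bigr => l _ /=.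
    rewrite (derive_mx dA) (derive_mx dB) !mxE addrC /GRing.scale /=.
    by rewrite [X in _ + X]mulrC.
  apply: is_derive_sum => l.
  by apply: is_deriveM; apply: derivableP; move: l; [move/derivable_mxP: dA|
     move/derivable_mxP: dB].
rewrite derive_mx; last by apply/derivable_mxP => i j; have [] := dAB i j.
by apply/matrixP => i j; rewrite mxE; have [_ ->] := dAB i j.
Qed.

End Smoothness.

(** * Symmetry of second derivatives *)

Section MixedDerivatives.
Context (R : realType) (V : normedModType R).
Implicit Types (U : set V) (x y u v w : V).

Lemma is_derive_line (W : normedModType R) (f : V -> W) u w (t : R) :
  differentiable f (t *: u + w) ->
  is_derive t 1 (fun s => f (s *: u + w)) ('D_u f (t *: u + w)).
Proof.
move=> df; pose F s := f (s *: u + w).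
have E : (fun h : R => h^-1 *: ((F \o shift t) (h *: 1) - F t)) =
    (fun h : R => h^-1 *: ((f \o shift (t *: u + w)) (h *: u) - f (t *: u + w))).
  apply/funext => h; rewrite /F /= /shift /=; congr (_ *: (f _ - _)).
  by rewrite [h *: 1]mulr1 scalerDl addrA.
by split; [rewrite /derivable E; exact: diff_derivable|rewrite /derive E].
Qed.

(** The mean value theorem applied first to the difference of f along two
    parallel edges of a parallelogram, then to D_u f along the other direction. *)
Lemma second_difference (f : V -> R) U y u v (h : R) : 0 < h ->
  (forall s t, 0 <= s <= h -> 0 <= t <= h -> U (s *: u + (t *: v + y))) ->
  Ck 2 U f ->
  exists s t, [/\ 0 <= s <= h, 0 <= t <= h &
    f (h *: u + (h *: v + y)) - f (h *: u + (0 *: v + y))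
    - (f (0 *: u + (h *: v + y)) - f (0 *: u + (0 *: v + y)))
    = 'D_v ('D_u f) (s *: u + (t *: v + y)) * h * h].
Proof.
move=> h0 inU [df /(_ u)[ddf _]].
have hh : 0 <= h <= h by rewrite (ltW h0) lexx.
have h00 : (0 : R) <= 0 <= h by rewrite lexx (ltW h0).
pose phi s := f (s *: u + (h *: v + y)) - f (s *: u + (0 *: v + y)).
have dphi s : 0 <= s <= h -> is_derive s 1 phi
    ('D_u f (s *: u + (h *: v + y)) - 'D_u f (s *: u + (0 *: v + y))).
  by move=> sh; apply: is_deriveB; apply: is_derive_line; apply: df; apply: inU.
have cphi : {within `[0, h], continuous phi}.
  apply: derivable_within_continuous => s; rewrite in_itv => /= /dphi [].
  by [].
have io s : s \in `]0, h[ -> 0 <= s <= h.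
  by rewrite in_itv /= => /andP[/ltW -> /ltW ->].
have [s /io sh E1] := MVT h0 (fun s hs => dphi s (io s hs)) cphi.
pose psi t := 'D_u f (s *: u + (t *: v + y)).
have dpsi t : 0 <= t <= h -> is_derive t 1 psi
    ('D_v ('D_u f) (s *: u + (t *: v + y))).
  move=> th.
  rewrite (_ : psi = fun t => 'D_u f (t *: v + (s *: u + y))); last first.
    by apply/funext => t'; rewrite /psi addrCA.
  rewrite addrCA; apply: is_derive_line; rewrite addrCA.
  by apply: ddf; apply: inU.
have cpsi : {within `[0, h], continuous psi}.
  apply: derivable_within_continuous => t; rewrite in_itv => /= /dpsi [].
  by [].
have [t /io th E2] := MVT h0 (fun t ht => dpsi t (io t ht)) cpsi.
exists s, t; split => //.
move: E1 E2; rewrite /phi /psi !subr0 => -> ->; by [].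
Qed.

Lemma second_difference_cancel (a b c d p q e : R) : e != 0 ->
  a - b - (c - d) = p * e * e -> a - c - (b - d) = q * e * e -> p = q.
Proof.
move=> e0 pE qE; apply: (mulIf e0); apply: (mulIf e0).
by rewrite -pE -qE; ring.
Qed.

Lemma distance_halves (a b q : R) :
  `|b - q| < `|a - b| / 2 -> `|a - q| < `|a - b| / 2 -> False.
Proof.
move=> bq aq; have := ler_distD q a b; rewrite leNgt => /negP; apply.
by rewrite [ltRHS]splitr ltrD// distrC.
Qed.

(** The two ways of computing the second difference over a small parallelogram
    produce values of D_v D_u f and of D_u D_v f at nearby points that agree;
    if the derivatives at y differed, continuity would contradict this. *)
Lemma schwarz (f : V -> R) U y u v : open U -> U y -> Ck 2 U f ->
  'D_u ('D_v f) y = 'D_v ('D_u f) y.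
Proof.
move=> oU Uy ckf; apply/eqP/negPn/negP => ne.
set A := 'D_u ('D_v f) y; set B := 'D_v ('D_u f) y.
have d0 : 0 < `|A - B| / 2 by rewrite divr_gt0// normr_gt0 subr_eq0.
have cA : {for y, continuous ('D_u ('D_v f))}.
  by case: ckf => _ /(_ v)[_ /(_ u)]; apply.
have cB : {for y, continuous ('D_v ('D_u f))}.
  by case: ckf => _ /(_ u)[_ /(_ v)]; apply.
have /cvgrPdist_lt /(_ _ d0) nA := cA.
have /cvgrPdist_lt /(_ _ d0) nB := cB.
have nU := open_nbhs_nbhs (conj oU Uy).
have [r /= r0 rP] := (nbhs_ballP _ _).1 (filterI nU (filterI nA nB)).
(* the parallelogram with edges h u and h v lies in the ball of radius r *)
pose c := `|u| + `|v| + 1.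
have c0 : 0 < c by rewrite ltr_wpDl// addr_ge0.
pose h := r / c.
have h0 : 0 < h by rewrite divr_gt0.
have inball s t : 0 <= s <= h -> 0 <= t <= h -> ball y r (s *: u + (t *: v + y)).
  move=> /andP[s0 sh] /andP[t0 th].
  rewrite -ball_normE /= distrC addrA addrK.
  apply: le_lt_trans (ler_normD _ _) _; rewrite !normrZ.
  rewrite (_ : r = h * c); last by rewrite /h divfK// gt_eqF.
  rewrite /c mulrDr mulr1 !mulrDr ltr_pwDr// lerD// ler_wpM2r//.
    by rewrite ger0_norm.
  by rewrite ger0_norm.
have [|s [t [hs ht E1]]] := @second_difference f U y u v h h0 _ ckf.
  by move=> s t hs ht; have /rP[] := inball s t hs ht.
have [|t' [s' [ht' hs' E2]]] := @second_difference f U y v u h h0 _ ckf.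
  by move=> s' t' hs' ht'; rewrite addrCA; have /rP[] := inball _ _ ht' hs'.
have inq : ball y r (t' *: v + (s' *: u + y)) by rewrite addrCA; exact: inball.
pose P : R := 'D_v ('D_u f) (s *: u + (t *: v + y)).
pose Q : R := 'D_u ('D_v f) (t' *: v + (s' *: u + y)).
have bP : `|B - P| < `|A - B| / 2 := (rP _ (inball s t hs ht)).2.2.
have bQ : `|A - Q| < `|A - B| / 2 := (rP _ inq).2.1.
have PQ : P = Q.
  apply: second_difference_cancel (lt0r_neq0 h0) E1 _.
  by move: E2; rewrite 2!(addrCA (h *: v)) 2!(addrCA (0 *: v)); exact.
by move: bP; rewrite PQ => bP; exact: distance_halves bP bQ.
Qed.

Lemma schwarz_mx m n (A : V -> 'M[R]_(m, n)) U y u v :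
  open U -> U y -> Ck 2 U A -> 'D_u ('D_v A) y = 'D_v ('D_u A) y.
Proof.
move=> oU Uy ckA.
have D w w' i j : 'D_w ('D_w' A) y i j = 'D_w ('D_w' (fun z => A z i j)) y.
  case: ckA => dA /(_ w')[ddA _].
  rewrite derive_mx ?mxE; last exact/diff_derivable/ddA.
  apply: near_eq_derive; apply: filterS (open_nbhs_nbhs (conj oU Uy)) => z Uz.
  by rewrite derive_mx ?mxE//; exact/diff_derivable/dA.
apply/matrixP => i j.
transitivity ('D_u ('D_v (fun z => A z i j)) y); first exact: D.
transitivity ('D_v ('D_u (fun z => A z i j)) y); last exact/esym/D.
exact: schwarz oU Uy ((Ck_mxP 2 A oU).1 ckA i j).
Qed.

Lemma derive_trmx m n (A : V -> 'M[R]_(m, n)) y v :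
  derivable A y v -> 'D_v (fun z => (A z)^T) y = ('D_v A y)^T.
Proof.
move=> dA; have dAT : derivable (fun z => (A z)^T) y v.
  apply/derivable_mxP => i j.
  have -> : (fun z => (A z)^T i j) = (fun z => A z j i).
    by apply/funext => z; rewrite mxE.
  exact: ((derivable_mxP A y v).1 dA j i).
rewrite !derive_mx//; apply/matrixP => i j; rewrite !mxE.
have -> // : (fun z => (A z)^T i j) = (fun z => A z j i).
by apply/funext => z; rewrite mxE.
Qed.

Lemma Ck_derivable (W : normedModType R) k U (f : V -> W) y v :
  U y -> Ck k.+1 U f -> derivable f y v.
Proof. by move=> Uy [df _]; exact/diff_derivable/df. Qed.

End MixedDerivatives.

(** * Levi-Civita connection and curvature in coordinates *)

Section MatrixForms.
Context (R : realType) (n : nat).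
Implicit Types (A B G : 'M[R]_n) (u v w : 'rV[R]_n).

Lemma mulmx_ext m p (A B : 'M[R]_(m, p)) :
  (forall w : 'rV[R]_m, w *m A = w *m B) -> A = B.
Proof. by move=> AB; apply/row_matrixP => i; rewrite !rowE AB. Qed.

Lemma innerE G u v : inner G u v = \sum_i (u *m G) 0 i * v 0 i.
Proof. by rewrite /inner mxE; apply: eq_bigr => i _; rewrite [v^T _ _]mxE. Qed.

Lemma inner_delta G u k : inner G u (delta_mx 0 k) = (u *m G) 0 k.
Proof. by rewrite /inner trmx_delta -colE mxE. Qed.

Lemma innerDl G u v w : inner G (u + v) w = inner G u w + inner G v w.
Proof. by rewrite /inner !mulmxDl mxE. Qed.

Lemma innerZl G a u w : inner G (a *: u) w = a * inner G u w.
Proof. by rewrite /inner -!scalemxAl mxE. Qed.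

Lemma innerDr G u v w : inner G u (v + w) = inner G u v + inner G u w.
Proof. by rewrite /inner linearD mulmxDr mxE. Qed.

Lemma innerZr G a u w : inner G u (a *: w) = a * inner G u w.
Proof. by rewrite /inner linearZ -scalemxAr mxE. Qed.

Lemma innerNl G u w : inner G (- u) w = - inner G u w.
Proof. by rewrite -scaleN1r innerZl mulN1r. Qed.

Lemma inner_sym G u v : G^T = G -> inner G u v = inner G v u.
Proof.
move=> GT; rewrite /inner.
transitivity ((u *m G *m v^T)^T 0 0); first by rewrite [RHS]mxE.
by rewrite !trmx_mul trmxK GT mulmxA.
Qed.

End MatrixForms.

(** With A and D_j the derivatives of the metric along u and along the j-th
    coordinate, this is the matrix of v |-> 2 Nabla_u v with lowered index. *)
Definition koszul_mx (R : realType) (n : nat) (A : 'M[R]_n)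
    (D : 'I_n -> 'M[R]_n) (u : 'rV[R]_n) : 'M[R]_n :=
  \matrix_(j, k) (A j k + (u *m D j) 0 k - (u *m D k) 0 j).

Lemma mul_koszul_mx (R : realType) (n : nat) (A : 'M[R]_n)
    (D : 'I_n -> 'M[R]_n) (u v : 'rV[R]_n) :
  \row_k (inner A v (delta_mx 0 k) +
          inner (\sum_j v 0 j *: D j) u (delta_mx 0 k) - inner (D k) u v) =
  v *m koszul_mx A D u.
Proof.
apply/rowP => k; rewrite mxE !inner_delta [RHS]mxE.
rewrite (eq_bigr (fun j => (v 0 j * A j k + v 0 j * (u *m D j) 0 k) -
   (u *m D k) 0 j * v 0 j)); last first.
  by move=> j _; rewrite [koszul_mx _ _ _ _ _]mxE; ring.
rewrite sumrB big_split /= -innerE; congr (_ + _ - _); first by rewrite mxE.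
rewrite mulmx_sumr summxE; apply: eq_bigr => j _.
by rewrite -scalemxAr [LHS]mxE.
Qed.

(** The last two terms of Koszul's formula are exchanged by transposition, up to
    sign: this is why the connection is metric. *)
Lemma koszul_mx_sym_part (R : realType) (n : nat) (A : 'M[R]_n)
    (D : 'I_n -> 'M[R]_n) (u : 'rV[R]_n) : A^T = A ->
  2^-1 *: koszul_mx A D u + (2^-1 *: koszul_mx A D u)^T = A.
Proof.
move=> AT; apply/matrixP => j k; have E i l : (2^-1 *: koszul_mx A D u) i l =
    2^-1 * (A i l + (u *m D i) 0 l - (u *m D l) 0 i).
  by rewrite [LHS]mxE; congr (_ * _); exact: mxE.
rewrite [LHS]mxE [X in _ + X]mxE !E.
have -> : A k j = A j k by rewrite -[in LHS]AT mxE.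
by field.
Qed.

(** In the next three lemmas Gu stands for the matrix of Nabla_u on constant
    vector fields and Duv for the derivative of Gv along u, so that the
    curvature of u, v is Duv - Dvu + Gv Gu - Gu Gv. The hypotheses are the
    vanishing of the torsion and of its derivatives, and the equality of D_u D_v and D_v D_u on the
    metric or on J after both derivatives have been expressed by the
    connection. *)
Lemma bianchi_algebra (R : realType) (n : nat) (u v w : 'rV[R]_n)
    (Gu Gv Gw Duv Dvu Dvw Dwv Dwu Duw : 'M[R]_n) :
  v *m Gu = u *m Gv -> w *m Gu = u *m Gw -> w *m Gv = v *m Gw ->
  w *m Duv = v *m Duw -> w *m Dvu = u *m Dvw -> u *m Dwv = v *m Dwu ->
  w *m (Duv - Dvu + Gv *m Gu - Gu *m Gv) +
  u *m (Dvw - Dwv + Gw *m Gv - Gv *m Gw) +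
  v *m (Dwu - Duw + Gu *m Gw - Gw *m Gu) = 0.
Proof.
move=> uv uw vw e1 e2 e3; rewrite !(mulmxDr, mulmxN) !mulmxA.
rewrite e1 e2 e3 uv uw vw; apply/eqP; rewrite -subr_eq0.
move: (v *m Duw) (u *m Dvw) (v *m Dwu) => a1 a2 a3.
move: (v *m Gw *m Gu) (u *m Gw *m Gv) (u *m Gv *m Gw) => b1 b2 b3.
by apply/eqP/rowP => k; rewrite !mxE; ring.
Qed.

Lemma metric_algebra (R : realType) (n : nat) (G Gu Gv Duv Dvu : 'M[R]_n) :
  Duv *m G + Gv *m (Gu *m G + G *m Gu^T) +
    ((Gu *m G + G *m Gu^T) *m Gv^T + G *m Duv^T) =
  Dvu *m G + Gu *m (Gv *m G + G *m Gv^T) +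
    ((Gv *m G + G *m Gv^T) *m Gu^T + G *m Dvu^T) ->
  (Duv - Dvu + Gv *m Gu - Gu *m Gv) *m G =
  - (G *m (Duv - Dvu + Gv *m Gu - Gu *m Gv)^T).
Proof.
move=> /eqP; rewrite -subr_eq0 => /eqP E.
apply/eqP; rewrite -subr_eq0 opprK; apply/eqP; rewrite -[RHS]E.
have -> : (Duv - Dvu + Gv *m Gu - Gu *m Gv)^T =
    Duv^T - Dvu^T + Gu^T *m Gv^T - Gv^T *m Gu^T.
  rewrite -!trmx_mul; move: (Gv *m Gu) (Gu *m Gv) => P Q.
  by apply/matrixP => i j; rewrite !mxE.
rewrite !(mulmxDl, mulmxDr, mulmxN, mulNmx, mulmxA).
move: (Duv *m G) (Dvu *m G) (G *m Duv^T) (G *m Dvu^T) => a1 a2 a3 a4.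
move: (Gv *m Gu *m G) (Gu *m Gv *m G) (Gv *m G *m Gu^T) (Gu *m G *m Gv^T).
move: (G *m Gu^T *m Gv^T) (G *m Gv^T *m Gu^T) => c1 c2 c3 c4 c5 c6.
by apply/matrixP => i j; rewrite !mxE; ring.
Qed.

Lemma parallel_algebra (R : realType) (n : nat) (J Gu Gv Duv Dvu : 'M[R]_n) :
  Duv *m J + Gv *m (Gu *m J - J *m Gu) -
    ((Gu *m J - J *m Gu) *m Gv + J *m Duv) =
  Dvu *m J + Gu *m (Gv *m J - J *m Gv) -
    ((Gv *m J - J *m Gv) *m Gu + J *m Dvu) ->
  (Duv - Dvu + Gv *m Gu - Gu *m Gv) *m J =
  J *m (Duv - Dvu + Gv *m Gu - Gu *m Gv).
Proof.
move=> /eqP; rewrite -subr_eq0 => /eqP E.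
apply/eqP; rewrite -subr_eq0; apply/eqP; rewrite -[RHS]E.
rewrite !(mulmxDl, mulmxDr, mulmxN, mulNmx, mulmxA).
move: (Duv *m J) (Dvu *m J) (J *m Duv) (J *m Dvu) => a1 a2 a3 a4.
move: (Gv *m Gu *m J) (Gu *m Gv *m J) (Gv *m J *m Gu) (Gu *m J *m Gv).
move: (J *m Gu *m Gv) (J *m Gv *m Gu) => c1 c2 c3 c4 c5 c6.
by apply/matrixP => i j; rewrite !mxE; ring.
Qed.

Local Opaque derive koszul_mx.

Section LeviCivita.
Context (R : realType) (n : nat).
Local Notation V := 'rV[R]_n.
Context (G : V -> 'M[R]_n) (U : set V).
Hypotheses (oU : open U) (smG : smooth_on U G).
Hypothesis (Gsym : forall z, U z -> (G z)^T = G z).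
Hypothesis (Gunit : forall z, U z -> G z \in unitmx).
Implicit Types (y u v w z : V).

(** Row vectors v are sent to Nabla_u v. The value is locked so that rewriting
    rules for products do not apply inside it. *)
Definition christoffel_mx (z u : V) : 'M[R]_n :=
  locked (2^-1 *: koszul_mx ('D_u G z) (fun j => 'D_(delta_mx 0 j) G z) u
          *m invmx (G z)).

Local Notation Gam := christoffel_mx.

Let derG z v : U z -> derivable G z v.
Proof. by move=> Uz; exact: Ck_derivable Uz (smG 1). Qed.

Lemma derive_metric_sym z v : U z -> ('D_v G z)^T = 'D_v G z.
Proof.
move=> Uz; rewrite -derive_trmx; last exact: derG.
apply: near_eq_derive; apply: filterS (open_nbhs_nbhs (conj oU Uz)) => x.
exact: Gsym.
Qed.

Lemma derive_metric_linear z v : U z ->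
  'D_v G z = \sum_j v 0 j *: 'D_(delta_mx 0 j) G z.
Proof.
move=> Uz; have dG : differentiable G z by have [] := smG 1 => /(_ z Uz).
rewrite deriveE// {1}(row_sum_delta v) linear_sum.
by apply: eq_bigr => j _; rewrite linearZ deriveE.
Qed.

Lemma christoffelE z u v : U z -> christoffel G z u v = v *m Gam z u.
Proof.
move=> Uz; rewrite /christoffel /Gam -lock mulmxA -scalemxAr -mul_koszul_mx.
by rewrite -(derive_metric_linear v Uz).
Qed.

Lemma christoffel_sym z u v : U z -> v *m Gam z u = u *m Gam z v.
Proof.
move=> Uz; rewrite -!christoffelE// /christoffel; congr (_ *: _ *m _).
apply/rowP => k; rewrite [LHS]mxE [RHS]mxE.
move: (derive_metric_sym (delta_mx 0 k) Uz).
move: ('D_u G z) ('D_v G z) ('D_(delta_mx 0 k) G z) => A B C CT.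
by rewrite (addrC (inner A _ _)) (inner_sym u v CT).
Qed.

Lemma derive_metric z u : U z ->
  'D_u G z = Gam z u *m G z + G z *m (Gam z u)^T.
Proof.
move=> Uz; have GT := Gsym Uz.
have -> : G z *m (Gam z u)^T = (Gam z u *m G z)^T.
  by rewrite [RHS]trmx_mul GT.
rewrite /Gam -lock -mulmxA mulVmx ?mulmx1; last exact: Gunit.
by rewrite koszul_mx_sym_part//; exact: derive_metric_sym.
Qed.

Lemma Ck_christoffel k u : Ck k U (Gam ^~ u).
Proof.
rewrite /Gam.
have -> : (fun z => locked (2^-1 *: koszul_mx ('D_u G z)
    (fun j => 'D_(delta_mx 0 j) G z) u *m invmx (G z))) =
  fun z => 2^-1 *: koszul_mx ('D_u G z)
    (fun j => 'D_(delta_mx 0 j) G z) u *m invmx (G z).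
  by apply/funext => z; rewrite -lock.
apply: Ck_mulmx => //; last exact: Ck_invmx (smG k).
have ckD v : Ck k U ('D_v G) by case: (smG k.+1) => _; exact.
have cku j : Ck k U (fun z => u *m 'D_(delta_mx 0 j) G z).
  by apply: Ck_mulmx => //; exact: Ck_cst.
apply/Ck_mxP => // i j.
have ent m p (A : V -> 'M[R]_(m, p)) a b : Ck k U A -> Ck k U (fun z => A z a b).
  by move=> /(Ck_mxP _ _ oU).
have -> : (fun z => (2^-1 *: koszul_mx ('D_u G z)
    (fun j => 'D_(delta_mx 0 j) G z) u) i j) = fun z =>
   2^-1 * (('D_u G z i j + (u *m 'D_(delta_mx 0 i) G z) 0 j)
           + (-1) * (u *m 'D_(delta_mx 0 j) G z) 0 i).
  apply/funext => z; rewrite [LHS]mxE mulN1r; congr (_ * _).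
  exact: mxE.
apply: Ck_mul => //; first exact: Ck_cst.
apply: Ck_add => //; first by apply: Ck_add => //; exact: ent.
by apply: Ck_mul => //; [exact: Ck_cst|exact: ent].
Qed.

Local Opaque christoffel_mx.

Let derGam z u v : U z -> derivable (Gam ^~ u) z v.
Proof. by move=> Uz; exact: Ck_derivable Uz (Ck_christoffel 1 u). Qed.

(** The matrix of w |-> R(u, v) w; see [curvatureE]. *)
Definition curvature_mx (z u v : V) : 'M[R]_n :=
  'D_u (Gam ^~ v) z - 'D_v (Gam ^~ u) z
  + Gam z v *m Gam z u - Gam z u *m Gam z v.

Local Notation Rm := curvature_mx.

Lemma derive_mulmxr z u m (w : 'M[R]_(m, n)) (A : V -> 'M[R]_n) :
  derivable A z u -> 'D_u (fun x => w *m A x) z = w *m 'D_u A z.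
Proof.
move=> dA; have := derive_mulmx (derivable_cst w z u) dA.
by rewrite derive_cst mul0mx add0r.
Qed.

Lemma nabla_const z u v w : U z ->
  nabla G (cst u) (nabla G (cst v) (cst w)) z =
  w *m ('D_u (Gam ^~ v) z + Gam z v *m Gam z u).
Proof.
move=> Uz; have E x : U x -> nabla G (cst v) (cst w) x = w *m Gam x v.
  by move=> Ux; rewrite /nabla /= derive_cst add0r christoffelE.
rewrite {1}/nabla /= E// christoffelE// mulmxDr mulmxA; congr (_ + _).
rewrite -derive_mulmxr; last exact: derGam.
apply: near_eq_derive; apply: filterS (open_nbhs_nbhs (conj oU Uz)) => x.
exact: E.
Qed.

Lemma curvatureE z u v w : U z ->
  curvature G (cst u) (cst v) (cst w) z = w *m Rm z u v.
Proof.
move=> Uz; rewrite /curvature !nabla_const//.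
have -> : lie_bracket (cst u) (cst v) = cst 0 :> (V -> V).
  by apply/funext => x; rewrite /lie_bracket !derive_cst subrr.
have -> : nabla G (cst 0) (cst w) z = 0.
  by rewrite /nabla /= derive_cst add0r christoffelE// christoffel_sym// mul0mx.
rewrite subr0 -mulmxBr; congr (_ *m _).
by rewrite /Rm opprD addrACA addrA.
Qed.

Lemma curvature_mx_anti z u v : Rm z u v = - Rm z v u.
Proof. by rewrite /Rm -addrA -(addrA (_ - _)) opprD !opprB. Qed.

Lemma curvature_mx_bianchi z u v w : U z ->
  w *m Rm z u v + u *m Rm z v w + v *m Rm z w u = 0.
Proof.
move=> Uz.
have D (a b c : V) : b *m 'D_a (Gam ^~ c) z = c *m 'D_a (Gam ^~ b) z.
  apply: etrans (esym (derive_mulmxr b (@derGam z c a Uz))) _.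
  apply: etrans (derive_mulmxr c (@derGam z b a Uz)).
  apply: near_eq_derive; apply: filterS (open_nbhs_nbhs (conj oU Uz)) => x Ux.
  exact: christoffel_sym.
by apply: bianchi_algebra; do ?exact: christoffel_sym; exact: D.
Qed.

(** Both sides of [derive_metric] are differentiated along a second vector, and
    the result is antisymmetrised. *)
Lemma curvature_mx_skew z u v : U z ->
  Rm z u v *m G z = - (G z *m (Rm z u v)^T).
Proof.
move=> Uz.
have DD (a b : V) : 'D_a ('D_b G) z =
  'D_a (Gam ^~ b) z *m G z + Gam z b *m (Gam z a *m G z + G z *m (Gam z a)^T) +
  ((Gam z a *m G z + G z *m (Gam z a)^T) *m (Gam z b)^T
    + G z *m ('D_a (Gam ^~ b) z)^T).
  rewrite -derive_metric//.
  have ckT : Ck 1 U (fun x => (Gam x b)^T) by exact: Ck_trmx oU (Ck_christoffel 1 b).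
  have d1 := derive_mulmx (@derGam z b a Uz) (@derG z a Uz).
  have d2 := derive_mulmx (@derG z a Uz) (Ck_derivable (v:=a) Uz ckT).
  have d3 := derive_trmx (@derGam z b a Uz).
  have d4 := deriveD (Ck_derivable (v:=a) Uz (Ck_mulmx oU (Ck_christoffel 1 b) (smG 1)))
    (Ck_derivable (v:=a) Uz (Ck_mulmx oU (smG 1) ckT)).
  apply: etrans _ (etrans d4 (congr2 +%R d1 (etrans d2 (congr1 _ (congr1 _ d3))))).
  apply: near_eq_derive; apply: filterS (open_nbhs_nbhs (conj oU Uz)) => x Ux.
  exact: derive_metric.
apply: metric_algebra; apply: etrans (esym (DD u v)) _.
exact: etrans (schwarz_mx u v oU Uz (smG 2)) (DD v u).
Qed.

Context (J : V -> 'M[R]_n).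
Hypothesis (smJ : smooth_on U J).
Hypothesis (parJ : forall z u, U z -> 'D_u J z = Gam z u *m J z - J z *m Gam z u).

(** As for the metric, starting from the equation for D_u J. *)
Lemma curvature_mx_parallel z u v : U z -> Rm z u v *m J z = J z *m Rm z u v.
Proof.
move=> Uz; have dJ a : derivable J z a by exact: Ck_derivable Uz (smJ 1).
have DD (a b : V) : 'D_a ('D_b J) z =
  'D_a (Gam ^~ b) z *m J z + Gam z b *m (Gam z a *m J z - J z *m Gam z a) -
  ((Gam z a *m J z - J z *m Gam z a) *m Gam z b + J z *m 'D_a (Gam ^~ b) z).
  rewrite -parJ//.
  have d1 := derive_mulmx (@derGam z b a Uz) (@dJ a).
  have d2 := derive_mulmx (@dJ a) (@derGam z b a Uz).
  have d4 := deriveB (Ck_derivable (v:=a) Uz (Ck_mulmx oU (Ck_christoffel 1 b) (smJ 1)))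
    (Ck_derivable (v:=a) Uz (Ck_mulmx oU (smJ 1) (Ck_christoffel 1 b))).
  apply: etrans _ (etrans d4 (congr2 _ d1 (congr1 _ d2))).
  apply: near_eq_derive; apply: filterS (open_nbhs_nbhs (conj oU Uz)) => x Ux.
  exact: parJ.
apply: parallel_algebra; apply: etrans (esym (DD u v)) _.
exact: etrans (schwarz_mx u v oU Uz (smJ 2)) (DD v u).
Qed.

End LeviCivita.

(** * Planes stable under a complex structure *)

Section Hermitian.
Context (R : realType) (n : nat) (G J : 'M[R]_n).
Hypothesis (Gsym : G^T = G).
Hypothesis (Gpos : forall u : 'rV[R]_n, u != 0 -> 0 < inner G u u).
Hypothesis (JJ : J *m J = - 1%:M).
Hypothesis (Jorth : forall u v : 'rV[R]_n, inner G (u *m J) (v *m J) = inner G u v).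
Implicit Types u v w : 'rV[R]_n.
Local Notation "<[ u , v ]>" := (inner G u v) (format "<[ u ,  v ]>").

Lemma innerC u v : <[u, v]> = <[v, u]>.
Proof. exact: inner_sym. Qed.

Lemma inner_eq0 u : <[u, u]> = 0 -> u = 0.
Proof.
by move=> u0; apply/eqP/negPn/negP => /Gpos; rewrite u0 ltxx.
Qed.

Lemma metric_unit : G \in unitmx.
Proof.
rewrite -row_free_unit -kermx_eq0; apply/negPn/negP => /rowV0Pn[u].
move=> /sub_kermxP uG u0; have := Gpos u0.
by rewrite /inner uG mul0mx mxE ltxx.
Qed.

Lemma mulJJ u : u *m J *m J = - u.
Proof. by rewrite -mulmxA JJ mulmxN mulmx1. Qed.

Lemma J_skew u v : <[u *m J, v]> = - <[u, v *m J]>.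
Proof. by rewrite -Jorth mulJJ innerNl. Qed.

Lemma inner_J_eq0 u : <[u, u *m J]> = 0.
Proof.
have /eqP := J_skew u u.
by rewrite innerC -addr_eq0 -mulr2n mulrn_eq0 => /eqP.
Qed.

Lemma normalized m (D : 'M[R]_(m, n)) : D != 0 ->
  exists2 e : 'rV[R]_n, (e <= D)%MS & <[e, e]> = 1.
Proof.
move=> /rowV0Pn[u uD u0].
exists ((Num.sqrt <[u, u]>)^-1 *: u); first exact: scalemx_sub.
have h := Gpos u0; rewrite innerZl innerZr mulrA -expr2 exprVn.
by rewrite sqr_sqrtr ?ltW// mulVf// gt_eqF.
Qed.

Lemma sub_span2 u e f : (u <= col_mx e f)%MS -> exists a b, u = a *: e + b *: f.
Proof.
move=> /submxP[w ->]; rewrite -[w]hsubmxK mul_row_col.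
exists (lsubmx w 0 0), (rsubmx w 0 0).
by rewrite [lsubmx w]mx11_scalar [rsubmx w]mx11_scalar !mul_scalar_mx !mxE eqxx !mulr1n.
Qed.

Lemma rank_col_mx_J e : <[e, e]> = 1 -> \rank (col_mx e (e *m J)) = 2.
Proof.
move=> e1; apply/eqP; rewrite -[_ == _]/(row_free _) -kermx_eq0.
apply/negPn/negP => /rowV0Pn[w /sub_kermxP]; rewrite -[w]hsubmxK mul_row_col.
rewrite [lsubmx w]mx11_scalar [rsubmx w]mx11_scalar !mul_scalar_mx.
set a := lsubmx w 0 0; set b := rsubmx w 0 0 => ab0 /negP; apply.
have a0 : a = 0.
  have := congr1 (inner G e) ab0; rewrite innerDr !innerZr e1 inner_J_eq0.
  by rewrite mulr1 mulr0 addr0 /inner linear0 mulmx0 mxE.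
have b0 : b = 0.
  have := congr1 (inner G (e *m J)) ab0; rewrite innerDr !innerZr Jorth e1.
  rewrite innerC inner_J_eq0.
  by rewrite mulr1 mulr0 add0r /inner linear0 mulmx0 mxE.
by rewrite a0 b0 !raddf0 row_mx0.
Qed.

Lemma stable_col_mx_J m (D : 'M[R]_(m, n)) (e : 'rV[R]_n) :
  stablemx D J -> (e <= D)%MS -> (col_mx e (e *m J) <= D)%MS.
Proof.
move=> sD eD; rewrite col_mx_sub eD /=.
exact: submx_trans (submxMr J eD) sD.
Qed.

Lemma stable_rank_ge2 m (D : 'M[R]_(m, n)) : stablemx D J -> D != 0 ->
  (2 <= \rank D)%N.
Proof.
move=> sD /normalized[e eD e1].
by have := mxrankS (stable_col_mx_J sD eD); rewrite rank_col_mx_J.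
Qed.

(** A J-stable plane is spanned by any of its unit vectors e and by Je, which
    are orthonormal. *)
Lemma stable_plane m (D : 'M[R]_(m, n)) e u : stablemx D J -> \rank D = 2 ->
  (e <= D)%MS -> <[e, e]> = 1 -> (u <= D)%MS ->
  u = <[u, e]> *: e + <[u, e *m J]> *: (e *m J).
Proof.
move=> sD rD eD e1 uD.
have : (u <= col_mx e (e *m J))%MS.
  apply: (submx_trans uD).
  by rewrite -(mxrank_leqif_sup (stable_col_mx_J sD eD)) rD rank_col_mx_J.
move=> /sub_span2[a [b ->]].
rewrite !(innerDl, innerZl) e1 Jorth e1 inner_J_eq0 innerC inner_J_eq0.
by rewrite !mulr1 !mulr0 addr0 add0r.
Qed.

Section Orthogonal.
Context (D : 'M[R]_n).
Local Notation D' := (orthogonal_complement G D).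

Lemma sub_orthogonalP u :
  reflect (forall d : 'rV[R]_n, (d <= D)%MS -> <[u, d]> = 0) (u <= D')%MS.
Proof.
rewrite /orthogonal_complement; apply: (iffP sub_kermxP) => [uD d|uD].
  by move=> /submxP[w ->]; rewrite /inner trmx_mul !mulmxA -(mulmxA u) uD mul0mx mxE.
rewrite mulmxA; apply/trmx_inj/row_matrixP => i.
rewrite trmx0 row0 trmx_mul trmxK row_mul.
have := uD (row i D) (row_sub i D); rewrite innerC /inner trmx_mul Gsym => E.
by apply/rowP => j; rewrite ord1 [RHS]mxE -E mulmxA.
Qed.

Lemma rank_orthogonal : \rank D' = (n - \rank D)%N.
Proof.
rewrite /orthogonal_complement mxrank_ker -mxrank_tr trmx_mul trmxK Gsym.
by rewrite mxrankMfree// row_free_unit metric_unit.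
Qed.

Lemma orthogonal_disjoint : (D :&: D')%MS = 0.
Proof.
apply/eqP/rowV0P => u; rewrite sub_capmx => /andP[uD /sub_orthogonalP/(_ _ uD)].
exact: inner_eq0.
Qed.

Lemma orthogonal_full u : (u <= D + D')%MS.
Proof.
apply: submx_full; rewrite /row_full; apply/eqP.
rewrite mxrank_disjoint_sum; last exact: orthogonal_disjoint.
by rewrite rank_orthogonal subnKC// rank_leq_col.
Qed.

Lemma proj_sub u : (orthogonal_projection G D u <= D)%MS.
Proof. exact: proj_mx_sub. Qed.

Lemma proj_compl_sub u : (u - orthogonal_projection G D u <= D')%MS.
Proof. exact/proj_mx_compl_sub/orthogonal_full. Qed.

Lemma stable_orthogonal : stablemx D J -> stablemx D' J.
Proof.
move=> sD; apply/row_subP => i; rewrite row_mul.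
apply/sub_orthogonalP => d dD; rewrite J_skew.
have /sub_orthogonalP -> := row_sub i D'; first by rewrite oppr0.
exact: submx_trans (submxMr J dD) sD.
Qed.

(** The projection is characterised by the orthogonal decomposition. *)
Lemma proj_unique u d : (d <= D)%MS -> (u - d <= D')%MS ->
  orthogonal_projection G D u = d.
Proof.
move=> dD ud; apply/eqP; rewrite -subr_eq0 -submx0 -orthogonal_disjoint.
rewrite sub_capmx addmx_sub ?eqmx_opp ?proj_sub//=.
rewrite (_ : _ - d = (u - d) - (u - orthogonal_projection G D u)); last first.
  by rewrite opprB [RHS]addrC addrA subrK.
by rewrite addmx_sub ?eqmx_opp ?proj_compl_sub.
Qed.

End Orthogonal.
End Hermitian.

(** * Unitary frames in dimension 4 *)

Section UnitaryFrame.
Context (R : realType) (G J : 'M[R]_4).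
Hypothesis (Gsym : G^T = G).
Hypothesis (Gpos : forall u : 'rV[R]_4, u != 0 -> 0 < inner G u u).
Hypothesis (JJ : J *m J = - 1%:M).
Hypothesis (Jorth : forall u v : 'rV[R]_4, inner G (u *m J) (v *m J) = inner G u v).
Implicit Types u v w : 'rV[R]_4.
Local Notation "<[ u , v ]>" := (inner G u v) (format "<[ u ,  v ]>").

Definition lin4 (e f : 'rV[R]_4) (a b c d : R) : 'rV[R]_4 :=
  a *: e + b *: (e *m J) + c *: f + d *: (f *m J).

Definition unitary_frame (e f : 'rV[R]_4) : Prop :=
  forall u, u = lin4 e f <[u, e]> <[u, e *m J]> <[u, f]> <[u, f *m J]>.

Definition orthonormal (e f : 'rV[R]_4) : Prop :=
  [/\ <[e, e]> = 1, <[f, f]> = 1, <[e, f]> = 0 & <[e, f *m J]> = 0].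

(** The plane D and its orthogonal complement are both J-stable planes, to which
    [stable_plane] applies. *)
Lemma adapted_frame (D : 'M[R]_4) : \rank D = 2 -> stablemx D J ->
  exists e f, [/\ orthonormal e f, unitary_frame e f,
    (e <= D)%MS, (f <= orthogonal_complement G D)%MS &
    forall u, orthogonal_projection G D u = <[u, e]> *: e + <[u, e *m J]> *: (e *m J)].
Proof.
move=> rD sD; have rD' : \rank (orthogonal_complement G D) = 2.
  by rewrite rank_orthogonal// rD.
have sD' := stable_orthogonal Gsym JJ Jorth sD.
have [|e eD e1] := normalized Gpos (D := D).
  by apply/eqP => D0; move: rD; rewrite D0 mxrank0.
have [|f fD' f1] := normalized Gpos (D := orthogonal_complement G D).
  by apply/eqP => D0; move: rD'; rewrite D0 mxrank0.
have eJD : (e *m J <= D)%MS := submx_trans (submxMr J eD) sD.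
have fJD' : (f *m J <= orthogonal_complement G D)%MS :=
  submx_trans (submxMr J fD') sD'.
have perp d d' : (d <= D)%MS -> (d' <= orthogonal_complement G D)%MS ->
    <[d, d']> = 0.
  by move=> dD /(sub_orthogonalP Gsym)/(_ _ dD); rewrite innerC.
have ef : <[e, f]> = 0 by exact: perp.
have efJ : <[e, f *m J]> = 0 by exact: perp.
have pE u : orthogonal_projection G D u =
    <[u, e]> *: e + <[u, e *m J]> *: (e *m J).
  rewrite [LHS](stable_plane Gsym JJ Jorth sD rD eD e1 (proj_sub _ _ _)).
  have := proj_compl_sub Gsym Gpos D u => /(sub_orthogonalP Gsym) ud.
  have := ud _ eD; have := ud _ eJD; rewrite !innerDl !innerNl.
  by move=> /eqP; rewrite subr_eq0 => /eqP -> /eqP; rewrite subr_eq0 => /eqP ->.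
have qE u : u - orthogonal_projection G D u =
    <[u, f]> *: f + <[u, f *m J]> *: (f *m J).
  rewrite [LHS](stable_plane Gsym JJ Jorth sD' rD' fD' f1
    (proj_compl_sub _ _ _ _))//.
  by rewrite !innerDl !innerNl !(perp _ _ (proj_sub _ _ _))// !subr0.
exists e, f; split => // u.
by rewrite /lin4 -pE -[X in X = _](addrNK (orthogonal_projection G D u)) qE addrC addrA.
Qed.

Context (e f : 'rV[R]_4).
Hypothesis (oef : orthonormal e f) (fef : unitary_frame e f).
Local Notation L := (lin4 e f).

Lemma lin4_J a b c d : L a b c d *m J = L (- b) a (- d) c.
Proof.
rewrite /lin4 !mulmxDl -!scalemxAl !mulJJ// !scalerN !scaleNr.
by rewrite (addrC (a *: _)) -!addrA (addrC (c *: _)).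
Qed.

Lemma orthonormal_table :
  (<[e, e]> = 1) * (<[f, f]> = 1) *
  (<[e *m J, e *m J]> = 1) * (<[f *m J, f *m J]> = 1) *
  (<[e, e *m J]> = 0) * (<[e *m J, e]> = 0) *
  (<[f, f *m J]> = 0) * (<[f *m J, f]> = 0) *
  (<[e, f]> = 0) * (<[f, e]> = 0) *
  (<[e, f *m J]> = 0) * (<[f *m J, e]> = 0) *
  (<[e *m J, f]> = 0) * (<[f, e *m J]> = 0) *
  (<[e *m J, f *m J]> = 0) * (<[f *m J, e *m J]> = 0).
Proof.
case: oef => e1 f1 ef efJ.
have C u v : <[u, v]> = <[v, u]> by exact: innerC.
have eJf : <[e *m J, f]> = 0 by rewrite (J_skew JJ Jorth) efJ oppr0.
have eeJ : <[e, e *m J]> = 0 by exact: inner_J_eq0.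
have ffJ : <[f, f *m J]> = 0 by exact: inner_J_eq0.
by do !split; rewrite ?Jorth// C// Jorth.
Qed.

Lemma inner_lin4 a b c d a' b' c' d' :
  <[L a b c d, L a' b' c' d']> = a * a' + b * b' + c * c' + d * d'.
Proof.
rewrite /lin4 !(innerDl, innerDr, innerZl, innerZr) !orthonormal_table; ring.
Qed.

Lemma coords_lin4 a b c d : [/\ <[L a b c d, e]> = a, <[L a b c d, e *m J]> = b,
  <[L a b c d, f]> = c & <[L a b c d, f *m J]> = d].
Proof.
by rewrite /lin4 !(innerDl, innerZl) !orthonormal_table; split; ring.
Qed.

Lemma lin4_e : e = L 1 0 0 0.
Proof. by rewrite /lin4 scale1r !scale0r !addr0. Qed.

Lemma lin4_f : f = L 0 0 1 0.
Proof. by rewrite /lin4 scale1r !scale0r !addr0 add0r. Qed.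

Lemma lin4_eJ : e *m J = L 0 1 0 0.
Proof. by rewrite {1}lin4_e lin4_J oppr0. Qed.

Lemma lin4D a b c d a' b' c' d' :
  L a b c d + L a' b' c' d' = L (a + a') (b + b') (c + c') (d + d').
Proof. by rewrite /lin4 !scalerDl; apply/rowP => i; rewrite !mxE; ring. Qed.

Lemma lin4Z x a b c d : x *: L a b c d = L (x * a) (x * b) (x * c) (x * d).
Proof. by rewrite /lin4 !scalerDr !scalerA. Qed.

Lemma lin4N a b c d : - L a b c d = L (- a) (- b) (- c) (- d).
Proof. by rewrite -scaleN1r lin4Z !mulN1r. Qed.

Definition frame_vec (i : nat) : 'rV[R]_4 := nth 0 [:: e; e *m J; f; f *m J] i.

Lemma complex_frameE (K : 'M[R]_4) u v :
  complex_frame K u v = \matrix_(i < 4) nth 0 [:: u; u *m K; v; v *m K] i.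
Proof.
apply/matrixP => i j; rewrite [RHS]mxE [LHS]mxE.
case: splitP => k ik; rewrite mxE; case: splitP => l kl; rewrite ord1 ik kl.
- by rewrite !ord1.
- by rewrite !ord1.
- by rewrite !ord1.
- by rewrite !ord1.
Qed.

(** Expands the rows of A in the frame. *)
Lemma frame_coordinates (A : 'M[R]_4) :
  A = (\matrix_(i, j) <[row i A, frame_vec j]>) *m complex_frame J e f.
Proof.
apply/row_matrixP => i; rewrite row_mul mulmx_sum_row complex_frameE.
rewrite !big_ord_recl big_ord0 !rowK /= !mxE /=.
by rewrite {1}(fef (row i A)) /lin4 addr0 !addrA.
Qed.

(** The identity matrix factors through the frame by [frame_coordinates]. *)
Lemma frame_det_neq0 : \det (complex_frame J e f) != 0.
Proof.
rewrite -unitfE -unitmxE; have := frame_coordinates 1%:M => /esym/mulmx1_unit[].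
by [].
Qed.

Lemma det_mx44 (M : nat -> nat -> R) : \det (\matrix_(i < 4, j < 4) M i j) =
  M 0 0 * (M 1 1 * (M 2 2 * M 3 3 - M 2 3 * M 3 2)
         - M 1 2 * (M 2 1 * M 3 3 - M 2 3 * M 3 1)
         + M 1 3 * (M 2 1 * M 3 2 - M 2 2 * M 3 1))
  - M 0 1 * (M 1 0 * (M 2 2 * M 3 3 - M 2 3 * M 3 2)
         - M 1 2 * (M 2 0 * M 3 3 - M 2 3 * M 3 0)
         + M 1 3 * (M 2 0 * M 3 2 - M 2 2 * M 3 0))
  + M 0 2 * (M 1 0 * (M 2 1 * M 3 3 - M 2 3 * M 3 1)
         - M 1 1 * (M 2 0 * M 3 3 - M 2 3 * M 3 0)
         + M 1 3 * (M 2 0 * M 3 1 - M 2 1 * M 3 0))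
  - M 0 3 * (M 1 0 * (M 2 1 * M 3 2 - M 2 2 * M 3 1)
         - M 1 1 * (M 2 0 * M 3 2 - M 2 2 * M 3 0)
         + M 1 2 * (M 2 0 * M 3 1 - M 2 1 * M 3 0)).
Proof.
have det2 (N : nat -> nat -> R) : \det (\matrix_(i < 2, j < 2) N i j) =
   N 0 0 * N 1 1 - N 0 1 * N 1 0.
  rewrite (expand_det_row _ ord0) !big_ord_recl big_ord0 /cofactor !det_mx11.
  by rewrite !mxE /=; ring.
have det3 (N : nat -> nat -> R) : \det (\matrix_(i < 3, j < 3) N i j) =
   N 0 0 * (N 1 1 * N 2 2 - N 1 2 * N 2 1) - N 0 1 * (N 1 0 * N 2 2 - N 1 2 * N 2 0)
   + N 0 2 * (N 1 0 * N 2 1 - N 1 1 * N 2 0).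
  rewrite (expand_det_row _ ord0) !big_ord_recl big_ord0 /cofactor.
  have E (k : 'I_3) : \det (row' ord0 (col' k (\matrix_(i < 3, j < 3) N i j))) =
      N 1 (bump k 0) * N 2 (bump k 1) - N 1 (bump k 1) * N 2 (bump k 0).
    rewrite -(det2 (fun i j => N i.+1 (bump k j))); congr (\det _).
    by apply/matrixP => i j; rewrite !mxE.
  by rewrite !E !mxE /=; ring.
rewrite (expand_det_row _ ord0) !big_ord_recl big_ord0 /cofactor.
have E (k : 'I_4) : \det (row' ord0 (col' k (\matrix_(i < 4, j < 4) M i j))) =
    let N i j := M i.+1 (bump k j) in
    N 0 0 * (N 1 1 * N 2 2 - N 1 2 * N 2 1) - N 0 1 * (N 1 0 * N 2 2 - N 1 2 * N 2 0)
    + N 0 2 * (N 1 0 * N 2 1 - N 1 1 * N 2 0).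
  rewrite /= -(det3 (fun i j => M i.+1 (bump k j))); congr (\det _).
  by apply/matrixP => i j; rewrite !mxE.
rewrite !E !mxE /=; ring.
Qed.

(** Orientations are compared by computing all determinants relatively to the
    same frame. *)
Lemma det_complex_frame (K : 'M[R]_4) u v :
  let M i j := <[nth 0 [:: u; u *m K; v; v *m K] i, frame_vec j]> in
  \det (complex_frame K u v) =
  \det (\matrix_(i < 4, j < 4) M i j) * \det (complex_frame J e f).
Proof.
rewrite /= {1}(frame_coordinates (complex_frame K u v)) det_mulmx; congr (\det _ * _).
by apply/matrixP => i j; rewrite !mxE complex_frameE rowK.
Qed.

End UnitaryFrame.

(** * Curvature tensors of Kaehler type *)

Section KaehlerCurvature.
Context (R : realType) (G J : 'M[R]_4).
Implicit Types u v w z : 'rV[R]_4.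

(** The Bianchi identity is represented by its consequence, the symmetry in
    pairs, which together with the antisymmetry also carries the properties
    stated for the first arguments over to the others. *)
Definition kaehler_tensor (Rm : 'rV[R]_4 -> 'rV[R]_4 -> 'rV[R]_4 -> 'rV[R]_4 -> R) :=
  [/\ forall a u u' v w z, Rm (a *: u + u') v w z = a * Rm u v w z + Rm u' v w z,
      forall u v w z, Rm u v w z = - Rm v u w z,
      forall u v w z, Rm u v w z = Rm w z u v &
      forall u v w z, Rm (u *m J) (v *m J) w z = Rm u v w z].

Context (Rm : 'rV[R]_4 -> 'rV[R]_4 -> 'rV[R]_4 -> 'rV[R]_4 -> R).
Hypothesis kRm : kaehler_tensor Rm.
Hypothesis (JJ : J *m J = - 1%:M).
Context (e f : 'rV[R]_4).
Local Notation L := (lin4 J e f).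

Let RmDl u u' v w z : Rm (u + u') v w z = Rm u v w z + Rm u' v w z.
Proof. by case: kRm => /(_ 1 u u' v w z); rewrite scale1r mul1r. Qed.

Let RmC u v w z : Rm u v w z = - Rm v u w z.
Proof. by case: kRm. Qed.

Let Rm0l v w z : Rm 0 v w z = 0.
Proof.
have := RmDl 0 0 v w z; rewrite addr0 => /eqP.
by rewrite -subr_eq0 opprD addrA subrr add0r oppr_eq0 => /eqP.
Qed.

Let RmZl a u v w z : Rm (a *: u) v w z = a * Rm u v w z.
Proof. by case: kRm => /(_ a u 0 v w z); rewrite addr0 Rm0l addr0. Qed.

Let RmDr u v v' w z : Rm u (v + v') w z = Rm u v w z + Rm u v' w z.
Proof. by rewrite RmC RmDl opprD -!RmC. Qed.

Let RmZr a u v w z : Rm u (a *: v) w z = a * Rm u v w z.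
Proof. by rewrite RmC RmZl -mulrN -RmC. Qed.

Let Rm_swap u v w z : Rm u v w z = Rm w z u v.
Proof. by case: kRm. Qed.

Let RmC34 u v w z : Rm u v w z = - Rm u v z w.
Proof. by rewrite Rm_swap RmC Rm_swap. Qed.

Let RmJ u v w z : Rm (u *m J) (v *m J) w z = Rm u v w z.
Proof. by case: kRm. Qed.

Lemma Rm_diag u w z : Rm u u w z = 0.
Proof. by have /eqP := RmC u u w z; rewrite -addr_eq0 -mulr2n mulrn_eq0 => /eqP. Qed.

(** By invariance R(Je, Jf) = R(e, f) and R(Je, f) = - R(e, Jf), so among the six
    components of a bivector only four combinations matter. *)
Lemma Rm_pair x1 x2 x3 x4 y1 y2 y3 y4 w z :
  Rm (L x1 x2 x3 x4) (L y1 y2 y3 y4) w z =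
  (x1 * y2 - x2 * y1) * Rm e (e *m J) w z
  + (x3 * y4 - x4 * y3) * Rm f (f *m J) w z
  + (x1 * y3 - x3 * y1 + (x2 * y4 - x4 * y2)) * Rm e f w z
  + (x1 * y4 - x4 * y1 - (x2 * y3 - x3 * y2)) * Rm e (f *m J) w z.
Proof.
have eJf : Rm (e *m J) f w z = - Rm e (f *m J) w z.
  by rewrite -RmJ mulJJ// -scaleN1r RmZl mulN1r.
rewrite /lin4 !(RmDl, RmDr, RmZl, RmZr) !Rm_diag RmJ eJf.
rewrite (RmC (e *m J) e) (RmC (f *m J) f) (RmC f e) (RmC (f *m J) e).
rewrite (RmC f (e *m J)) eJf (RmC (f *m J) (e *m J)) RmJ; ring.
Qed.

Lemma Rm_lin4 (x1 x2 x3 x4 y1 y2 y3 y4 z1 z2 z3 z4 w1 w2 w3 w4 : R) :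
  let p := x1 * y2 - x2 * y1 in let q := x3 * y4 - x4 * y3 in
  let r := x1 * y3 - x3 * y1 + (x2 * y4 - x4 * y2) in
  let s := x1 * y4 - x4 * y1 - (x2 * y3 - x3 * y2) in
  let p' := z1 * w2 - z2 * w1 in let q' := z3 * w4 - z4 * w3 in
  let r' := z1 * w3 - z3 * w1 + (z2 * w4 - z4 * w2) in
  let s' := z1 * w4 - z4 * w1 - (z2 * w3 - z3 * w2) in
  Rm (L x1 x2 x3 x4) (L y1 y2 y3 y4) (L z1 z2 z3 z4) (L w1 w2 w3 w4) =
  p * p' * Rm e (e *m J) e (e *m J) + q * q' * Rm f (f *m J) f (f *m J)
  + (p * q' + q * p') * Rm e (e *m J) f (f *m J)
  + r * r' * Rm e f e f + s * s' * Rm e (f *m J) e (f *m J)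
  + (r * s' + s * r') * Rm e f e (f *m J)
  + (p * r' + r * p') * Rm e (e *m J) e f
  + (p * s' + s * p') * Rm e (e *m J) e (f *m J)
  + (q * r' + r * q') * Rm f (f *m J) e f
  + (q * s' + s * q') * Rm f (f *m J) e (f *m J).
Proof.
move=> p q r s p' q' r' s'.
have E u v : Rm u v (L z1 z2 z3 z4) (L w1 w2 w3 w4) =
  p' * Rm u v e (e *m J) + q' * Rm u v f (f *m J) + r' * Rm u v e f
  + s' * Rm u v e (f *m J).
  by rewrite Rm_swap Rm_pair !(Rm_swap _ _ u v).
rewrite Rm_pair -/p -/q -/r -/s !E.
rewrite (Rm_swap f (f *m J) e (e *m J)) (Rm_swap e f e (e *m J)).
rewrite (Rm_swap e f f (f *m J)) (Rm_swap e (f *m J) e (e *m J)).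
rewrite (Rm_swap e (f *m J) f (f *m J)) (Rm_swap e (f *m J) e f); ring.
Qed.

(** Rotating f in its complex line fixes the first two of the four numbers
    attached to a pair and rotates the last two; these equations say that the
    quadratic form of [Rm_lin4] is invariant under these rotations. *)
Definition circle_invariant :=
  [/\ Rm e (e *m J) e f = 0, Rm e (e *m J) e (f *m J) = 0,
      Rm f (f *m J) e f = 0, Rm f (f *m J) e (f *m J) = 0 &
      Rm e f e (f *m J) = 0 /\ Rm e f e f = Rm e (f *m J) e (f *m J)].

Definition gray (K : 'M[R]_4) : Prop := forall X Y Z W,
  Rm X Y Z W - Rm (X *m K) (Y *m K) Z W =
  Rm (X *m K) Y (Z *m K) W + Rm (X *m K) Y Z (W *m K).

Let RmZ3 a u v w z : Rm u v (a *: w) z = a * Rm u v w z.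
Proof. by rewrite Rm_swap RmZl Rm_swap. Qed.

Let RmZ4 a u v w z : Rm u v w (a *: z) = a * Rm u v w z.
Proof. by rewrite Rm_swap RmZr Rm_swap. Qed.

Lemma gray_scale s K : s * s = 1 -> gray K -> gray (s *: K).
Proof.
move=> ss gK X Y Z W; rewrite -!scalemxAr !(RmZl, RmZr, RmZ3, RmZ4) !mulrA ss.
by rewrite !mul1r; exact: gK.
Qed.

(** For the pair X, JX the four numbers are p, q, r, s below, and
    r^2 + s^2 = 4 p q. *)
Lemma hol_lin4 x1 x2 x3 x4 : let u := L x1 x2 x3 x4 in
  Rm u (u *m J) (u *m J) u = - (
  let p := x1 ^+ 2 + x2 ^+ 2 in let q := x3 ^+ 2 + x4 ^+ 2 in
  let r := 2 * (x2 * x3 - x1 * x4) in let s := 2 * (x1 * x3 + x2 * x4) in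
  p * p * Rm e (e *m J) e (e *m J) + q * q * Rm f (f *m J) f (f *m J)
  + 2 * p * q * Rm e (e *m J) f (f *m J)
  + r * r * Rm e f e f + s * s * Rm e (f *m J) e (f *m J)
  + 2 * r * s * Rm e f e (f *m J)
  + 2 * p * r * Rm e (e *m J) e f
  + 2 * p * s * Rm e (e *m J) e (f *m J)
  + 2 * q * r * Rm f (f *m J) e f
  + 2 * q * s * Rm f (f *m J) e (f *m J)).
Proof.
rewrite /= RmC34 (lin4_J JJ) Rm_lin4; congr (- _); ring.
Qed.

Lemma circle_invariant_hol x1 x2 x3 x4 : circle_invariant ->
  let u := L x1 x2 x3 x4 in
  Rm u (u *m J) (u *m J) u = - (
  let p := x1 ^+ 2 + x2 ^+ 2 in let q := x3 ^+ 2 + x4 ^+ 2 in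
  p * p * Rm e (e *m J) e (e *m J) + q * q * Rm f (f *m J) f (f *m J)
  + 2 * p * q * Rm e (e *m J) f (f *m J) + 4 * p * q * Rm e f e f).
Proof.
move=> [c1 c2 c3 c4 [c5 c6]]; rewrite /= hol_lin4 /= c1 c2 c3 c4 c5 -c6; ring.
Qed.

(** Only the part of the quadratic form that depends on (r, s) varies when the
    component in the complement of D moves on a circle; the unit vectors are
    x e + s f + t Jf. Reversing that component isolates the terms linear in
    (r, s); two different ratios between the components along D and its
    complement then separate the coefficients. Rotating it by a right angle, and
    reflecting it, give the equations on the terms quadratic in (r, s). *)
Lemma hol_circle_invariant :
  (forall x1 x2 x3 x4 y1 y2 y3 y4 : R,
    x1 ^+ 2 + x2 ^+ 2 + x3 ^+ 2 + x4 ^+ 2 = 1 ->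
    y1 ^+ 2 + y2 ^+ 2 + y3 ^+ 2 + y4 ^+ 2 = 1 ->
    x1 ^+ 2 + x2 ^+ 2 = y1 ^+ 2 + y2 ^+ 2 ->
    let u := L x1 x2 x3 x4 in let v := L y1 y2 y3 y4 in
    Rm u (u *m J) (u *m J) u = Rm v (v *m J) (v *m J) v) -> circle_invariant.
Proof.
move=> H.
pose A := Rm e (e *m J) e (e *m J); pose B := Rm f (f *m J) f (f *m J).
pose C := Rm e (e *m J) f (f *m J); pose r11 := Rm e f e f.
pose r22 := Rm e (f *m J) e (f *m J); pose g := Rm e f e (f *m J).
pose a1 := Rm e (e *m J) e f; pose a2 := Rm e (e *m J) e (f *m J).
pose b1 := Rm f (f *m J) e f; pose b2 := Rm f (f *m J) e (f *m J).
have {}H (x s t s' t' : R) : x ^+ 2 + (s ^+ 2 + t ^+ 2) = 1 ->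
    s' ^+ 2 + t' ^+ 2 = s ^+ 2 + t ^+ 2 ->
    let F s t := let q := s ^+ 2 + t ^+ 2 in
      x ^+ 2 * t ^+ 2 * r11 + x ^+ 2 * s ^+ 2 * r22 - 2 * x ^+ 2 * s * t * g
      - x * t * (x ^+ 2 * a1 + q * b1) + x * s * (x ^+ 2 * a2 + q * b2) in
    F s t = F s' t'.
  move=> n1 n2 F.
  have n1' : x ^+ 2 + 0 ^+ 2 + s ^+ 2 + t ^+ 2 = 1 by rewrite -n1; ring.
  have n2' : x ^+ 2 + 0 ^+ 2 + s' ^+ 2 + t' ^+ 2 = 1 by rewrite -n1 -n2; ring.
  have := H x 0 s t x 0 s' t' n1' n2' erefl.
  rewrite /= !hol_lin4 /= n2.
  rewrite -/A -/B -/C -/r11 -/r22 -/g -/a1 -/a2 -/b1 -/b2 => /oppr_inj.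
  move: A B C => A B C /eqP; rewrite -subr_eq0 => /eqP E.
  have n4 : (4 : R) != 0 by rewrite pnatr_eq0.
  apply/eqP; rewrite -subr_eq0 -(inj_eq (mulfI n4)) mulr0 -E /F n2; apply/eqP.
  by ring.
have odd (c s : R) : c != 0 -> s != 0 -> c ^+ 2 + s ^+ 2 = 1 ->
    c ^+ 2 * a1 + s ^+ 2 * b1 = 0 /\ c ^+ 2 * a2 + s ^+ 2 * b2 = 0.
  move=> c0 s0 cs; have n0 : 2 * c * s != 0 by rewrite !mulf_neq0// pnatr_eq0.
  split; apply/eqP; rewrite -(inj_eq (mulfI n0)) mulr0.
    have /= := H c 0 s 0 (- s); rewrite sqrrN expr0n/= add0r => /(_ cs erefl).
    by move=> /eqP; rewrite eq_sym -subr_eq0 => /eqP E; rewrite -E; apply/eqP; ring.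
  have /= := H c s 0 (- s) 0; rewrite sqrrN expr0n/= addr0 => /(_ cs erefl).
  by move=> /eqP; rewrite -subr_eq0 => /eqP E; rewrite -E; apply/eqP; ring.
(* a rational point of the unit circle with different coordinates *)
have cs : (3 / 5) ^+ 2 + (4 / 5) ^+ 2 = 1 :> R by field.
have sc : (4 / 5) ^+ 2 + (3 / 5) ^+ 2 = 1 :> R by field.
have c0 : 3 / 5 != 0 :> R by apply: lt0r_neq0; lra.
have s0 : 4 / 5 != 0 :> R by apply: lt0r_neq0; lra.
have [h1 h2] := odd _ _ c0 s0 cs; have [h3 h4] := odd _ _ s0 c0 sc.
have a10 : a1 = 0 by move: a1 b1 h1 h3 {H odd} => a1 b1; lra.
have b10 : b1 = 0 by move: a1 b1 h1 h3 {H odd a10} => a1 b1; lra.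
have a20 : a2 = 0 by move: a2 b2 h2 h4 {H odd} => a2 b2; lra.
have b20 : b2 = 0 by move: a2 b2 h2 h4 {H odd a20} => a2 b2; lra.
rewrite /= a10 b10 a20 b20 in H.
have r12 : r11 = r22.
  have /= := H (3 / 5) 0 (4 / 5) (4 / 5) 0; rewrite expr0n/= add0r addr0.
  by move=> /(_ cs erefl) {H}; move: r11 r22 g => r11 r22 g; lra.
have g0 : g = 0.
  have /= := H (3 / 5) (4 / 5 * (3 / 5)) (4 / 5 * (4 / 5))
    (4 / 5 * (3 / 5)) (- (4 / 5 * (4 / 5))).
  have nrm : (3 / 5) ^+ 2 + ((4 / 5 * (3 / 5)) ^+ 2 + (4 / 5 * (4 / 5)) ^+ 2) = 1 :> R.
    by field.
  rewrite sqrrN => /(_ nrm erefl) {H r12}.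
  by move: r11 r22 g => r11 r22 g; lra.
by split.
Qed.

Section Gray.
Context (K : 'M[R]_4).
Hypothesis (Ke : e *m K = e *m J) (KeJ : e *m J *m K = - e).
Hypothesis (Kf : f *m K = - (f *m J)) (KfJ : f *m J *m K = f).

Lemma lin4_K a b c d : L a b c d *m K = L (- b) a d (- c).
Proof.
rewrite /lin4 !mulmxDl -!scalemxAl Ke KeJ Kf KfJ !scalerN !scaleNr.
by rewrite (addrC (a *: _)) -!addrA (addrC (- (c *: _))).
Qed.

(** A polynomial identity in the coordinates, by [Rm_lin4]. *)
Lemma circle_invariant_gray : unitary_frame G J e f -> circle_invariant -> gray K.
Proof.
move=> fef [c1 c2 c3 c4 [c5 c6]] X Y Z W.
rewrite (fef X) (fef Y) (fef Z) (fef W) !lin4_K !Rm_lin4.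
rewrite c1 c2 c3 c4 c5 -c6; ring.
Qed.

(** Each of the six equations is the Gray condition for one choice of frame
    vectors, with X = e and Y = f or Jf. *)
Lemma gray_circle_invariant : gray K -> circle_invariant.
Proof.
move=> gK.
have E1 := gK (L 1 0 0 0) (L 0 0 1 0) (L 1 0 0 0) (L 0 1 0 0).
have E2 := gK (L 1 0 0 0) (L 0 0 1 0) (L 0 0 1 0) (L 0 0 0 1).
have E3 := gK (L 1 0 0 0) (L 0 0 0 1) (L 1 0 0 0) (L 0 1 0 0).
have E4 := gK (L 1 0 0 0) (L 0 0 0 1) (L 0 0 1 0) (L 0 0 0 1).
have E5 := gK (L 1 0 0 0) (L 0 0 1 0) (L 1 0 0 0) (L 0 0 1 0).
have E6 := gK (L 1 0 0 0) (L 0 0 1 0) (L 1 0 0 0) (L 0 0 0 1).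
move: E1 E2 E3 E4 E5 E6; rewrite !lin4_K !Rm_lin4 /circle_invariant.
move: (Rm e (e *m J) e (e *m J)) (Rm f (f *m J) f (f *m J)) => A B.
move: (Rm e (e *m J) f (f *m J)) (Rm e f e f) => C r11.
move: (Rm e (f *m J) e (f *m J)) (Rm e f e (f *m J)) => r22 g.
move: (Rm e (e *m J) e f) (Rm e (e *m J) e (f *m J)) => a1 a2.
move: (Rm f (f *m J) e f) (Rm f (f *m J) e (f *m J)) => b1 b2.
move=> E1; have a10 : a1 = 0 by lra.
move=> {E1} E2; have b10 : b1 = 0 by lra.
move=> {E2} E3; have a20 : a2 = 0 by lra.
move=> {E3} E4; have b20 : b2 = 0 by lra.
move=> {E4} E5; have r12 : r11 = r22 by lra.
move=> {E5} E6; have g0 : g = 0 by lra.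
by [].
Qed.
End Gray.
End KaehlerCurvature.

(** * Orthogonal complex structures in dimension 4 *)

Section Quaternionic.
Context (R : realType) (G J : 'M[R]_4).
Hypothesis (Gsym : G^T = G).
Hypothesis (Gpos : forall u : 'rV[R]_4, u != 0 -> 0 < inner G u u).
Hypothesis (JJ : J *m J = - 1%:M).
Hypothesis (Jorth : forall u v : 'rV[R]_4, inner G (u *m J) (v *m J) = inner G u v).
Implicit Types u v w : 'rV[R]_4.
Local Notation "<[ u , v ]>" := (inner G u v) (format "<[ u ,  v ]>").

(** An orthogonal antisymmetric 4 x 4 matrix with entries a, b, c, p, q, r above
    the diagonal is self-dual or antiself-dual; the sign s is its Pfaffian. *)
Lemma orthogonal_antisymmetric (a b c p q r : R) :
  a * a + b * b + c * c = 1 -> a * a + p * p + q * q = 1 ->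
  b * b + p * p + r * r = 1 -> c * c + q * q + r * r = 1 ->
  b * p + c * q = 0 -> c * r - a * p = 0 -> a * q + b * r = 0 ->
  a * b + q * r = 0 -> a * c - p * r = 0 -> b * c + p * q = 0 ->
  exists s, [/\ s * s = 1, r = s * a, q = - (s * b) & p = s * c].
Proof.
move=> n1 n2 n3 n4 o12 o13 o14 o23 o24 o34.
have ar : a * a = r * r by lra.
have bq : b * b = q * q by lra.
have cp : c * c = p * p by lra.
pose s := a * r - b * q + c * p.
have rE : r = s * a.
  rewrite -[LHS]mulr1 -n2 /s; apply/eqP; rewrite -subr_eq0; apply/eqP.
  rewrite (_ : _ - _ = q * (a * b + q * r) - p * (a * c - p * r)); last by ring.
  by rewrite o23 o24; ring.
have qE : q = - (s * b).
  rewrite -[LHS]mulr1 -n3 /s; apply/eqP; rewrite -subr_eq0; apply/eqP.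
  rewrite (_ : _ - _ = r * (a * b + q * r) + p * (b * c + p * q)); last by ring.
  by rewrite o23 o34; ring.
have pE : p = s * c.
  rewrite -[LHS]mulr1 -n4 /s; apply/eqP; rewrite -subr_eq0; apply/eqP.
  rewrite (_ : _ - _ = q * (b * c + p * q) - r * (a * c - p * r)); last by ring.
  by rewrite o34 o24; ring.
exists s; split => //.
have sa : s * s * (a * a) = a * a by rewrite [RHS]ar rE; ring.
have sb : s * s * (b * b) = b * b by rewrite [RHS]bq qE; ring.
have sc : s * s * (c * c) = c * c by rewrite [RHS]cp pE; ring.
by rewrite -[LHS]mulr1 -{1}n1 2!(mulrDr (s * s)) sa sb sc.
Qed.

Section Frame.
Context (e f : 'rV[R]_4).
Hypothesis (oef : orthonormal G J e f) (fef : unitary_frame G J e f).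
Local Notation L := (lin4 J e f).
Local Notation dF := (\det (complex_frame J e f)).
Let coords := coords_lin4 Gsym JJ Jorth oef.

Lemma det_complex_frame_lin4 (K : 'M[R]_4) a1 a2 a3 a4 b1 b2 b3 b4
    c1 c2 c3 c4 d1 d2 d3 d4 :
  L a1 a2 a3 a4 *m K = L b1 b2 b3 b4 -> L c1 c2 c3 c4 *m K = L d1 d2 d3 d4 ->
  \det (complex_frame K (L a1 a2 a3 a4) (L c1 c2 c3 c4)) =
  (a1 * (b2 * (c3 * d4 - c4 * d3) - b3 * (c2 * d4 - c4 * d2)
         + b4 * (c2 * d3 - c3 * d2))
  - a2 * (b1 * (c3 * d4 - c4 * d3) - b3 * (c1 * d4 - c4 * d1)
         + b4 * (c1 * d3 - c3 * d1))
  + a3 * (b1 * (c2 * d4 - c4 * d2) - b2 * (c1 * d4 - c4 * d1)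
         + b4 * (c1 * d2 - c2 * d1))
  - a4 * (b1 * (c2 * d3 - c3 * d2) - b2 * (c1 * d3 - c3 * d1)
         + b3 * (c1 * d2 - c2 * d1))) * dF.
Proof.
move=> aK cK; rewrite (det_complex_frame fef K); congr (_ * _).
rewrite aK cK.
pose v i := nth 0 [:: L a1 a2 a3 a4; L b1 b2 b3 b4; L c1 c2 c3 c4; L d1 d2 d3 d4] i.
rewrite (det_mx44 (fun i j => <[v i, frame_vec J e f j]>)) /v /frame_vec /=.
have [p1 p2 p3 p4] := coords a1 a2 a3 a4; rewrite p1 p2 p3 p4.
have [q1 q2 q3 q4] := coords b1 b2 b3 b4; rewrite q1 q2 q3 q4.
have [r1 r2 r3 r4] := coords c1 c2 c3 c4; rewrite r1 r2 r3 r4.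
have [s1 s2 s3 s4] := coords d1 d2 d3 d4; rewrite s1 s2 s3 s4.
by [].
Qed.

(** The factor is the squared modulus of the complex determinant of the
    coordinates of u and v. *)
Lemma det_frame_J u v : exists2 t, 0 <= t & \det (complex_frame J u v) = t * dF.
Proof.
rewrite (fef u) (fef v); move: <[u, e]> <[u, e *m J]> <[u, f]> <[u, f *m J]>.
move: <[v, e]> <[v, e *m J]> <[v, f]> <[v, f *m J]> => y1 y2 y3 y4 x1 x2 x3 x4.
rewrite (det_complex_frame_lin4 (lin4_J JJ _ _ _ _ _ _) (lin4_J JJ _ _ _ _ _ _)).
exists ((x1 * y3 - x2 * y4 - x3 * y1 + x4 * y2) ^+ 2
  + (x1 * y4 + x2 * y3 - x3 * y2 - x4 * y1) ^+ 2).
  by rewrite addr_ge0// sqr_ge0.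
by congr (_ * _); ring.
Qed.

Section Reflected.
Context (K : 'M[R]_4).
Hypothesis (Ke : e *m K = e *m J) (KeJ : e *m J *m K = - e).
Hypothesis (Kf : f *m K = - (f *m J)) (KfJ : f *m J *m K = f).
Let LK := lin4_K Ke KeJ Kf KfJ.

(** K is conjugate to J by the reflection changing the sign of the fourth
    coordinate in the frame. *)
Lemma reflected_opposite : opposite_orientation J K.
Proof.
move=> u v u' v'; have [t t0 ->] := det_frame_J u v.
have [t' t0' ->] : exists2 t', 0 <= t' & \det (complex_frame K u' v') = - t' * dF.
  rewrite (fef u') (fef v'); move: <[u', e]> <[u', e *m J]> <[u', f]> <[u', f *m J]>.
move: <[v', e]> <[v', e *m J]> <[v', f]> <[v', f *m J]> => y1 y2 y3 y4 x1 x2 x3 x4.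
  rewrite (det_complex_frame_lin4 (LK _ _ _ _) (LK _ _ _ _)).
  exists ((x1 * y3 + x2 * y4 - x3 * y1 - x4 * y2) ^+ 2
    + (- x1 * y4 + x2 * y3 - x3 * y2 + x4 * y1) ^+ 2).
    by rewrite addr_ge0// sqr_ge0.
  by congr (_ * _); ring.
rewrite mulf_eq0 negb_or => /andP[tn dn].
rewrite mulf_eq0 oppr_eq0 negb_or => /andP[sn _].
have -> : t * dF * (- t' * dF) = - (t * t' * dF ^+ 2) by ring.
have d2 : 0 < dF ^+ 2 by rewrite lt0r sqrf_eq0 dn sqr_ge0.
by rewrite oppr_lt0 mulr_gt0// mulr_gt0// lt0r ?tn ?sn.
Qed.

Lemma reflected_acs : K *m K = - 1%:M.
Proof.
apply: mulmx_ext => u; by rewrite mulmxA mulmxN mulmx1 (fef u) !LK lin4N.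
Qed.

Lemma reflected_orthogonal u v : <[u *m K, v *m K]> = <[u, v]>.
Proof.
by rewrite (fef u) (fef v) !LK !(inner_lin4 Gsym JJ Jorth oef); ring.
Qed.
End Reflected.

Section Commute.
Context (K : 'M[R]_4).
Hypothesis (KK : K *m K = - 1%:M).
Hypothesis (Korth : forall u v : 'rV[R]_4, inner G (u *m K) (v *m K) = inner G u v).
Hypothesis (opp : opposite_orientation J K).

(** In a unitary frame K is antisymmetric and orthogonal, hence self-dual or
    antiself-dual. The self-dual ones have the orientation of J; the
    antiself-dual ones commute with J, which is self-dual. *)
Lemma opposite_commute : K *m J = J *m K.
Proof.
have Kskew u v : <[u *m K, v]> = - <[u, v *m K]> := J_skew KK Korth u v.
have Kin u : <[u, u *m K]> = 0 := inner_J_eq0 Gsym KK Korth u.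
have C u v : <[u, v]> = <[v, u]> := innerC Gsym u v.
set a := <[e *m K, e *m J]>; set b := <[e *m K, f]>; set c := <[e *m K, f *m J]>.
set p := <[e *m J *m K, f]>; set q := <[e *m J *m K, f *m J]>.
set r := <[f *m K, f *m J]>.
have E1 : e *m K = L 0 a b c by rewrite [LHS]fef (C _ e) Kin.
have E2 : e *m J *m K = L (- a) 0 p q.
  by rewrite [LHS]fef (Kskew _ e) (C _ (e *m K)) -/a (C _ (e *m J)) Kin.
have E3 : f *m K = L (- b) (- p) 0 r.
  rewrite [LHS]fef (Kskew _ e) (Kskew _ (e *m J)) (C _ f) Kin.
  by rewrite (C f (e *m K)) (C f (e *m J *m K)).
have E4 : f *m J *m K = L (- c) (- q) (- r) 0.
  rewrite [LHS]fef (Kskew _ e) (Kskew _ (e *m J)) (Kskew _ f).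
  by rewrite (C _ (f *m J)) Kin !(C (f *m J) (_ *m K)).
have O := inner_lin4 Gsym JJ Jorth oef.
have T := orthonormal_table Gsym JJ Jorth oef.
have n1 := Korth e e; have n2 := Korth (e *m J) (e *m J).
have n3 := Korth f f; have n4 := Korth (f *m J) (f *m J).
have o12 := Korth e (e *m J); have o13 := Korth e f; have o14 := Korth e (f *m J).
have o23 := Korth (e *m J) f; have o24 := Korth (e *m J) (f *m J).
have o34 := Korth f (f *m J).
rewrite E1 E2 E3 E4 !O !T in n1 n2 n3 n4 o12 o13 o14 o23 o24 o34.
have [||||||||||s [ss rE qE pE]] := @orthogonal_antisymmetric a b c p q r.
1-10: by clear -n1 n2 n3 n4 o12 o13 o14 o23 o24 o34; lra.
have dF0 : dF != 0 := frame_det_neq0 fef.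
have dF2 : 0 < dF * dF by rewrite -expr2 lt0r sqrf_eq0 dF0 sqr_ge0.
have sN : s = -1.
  have : (s - 1) * (s + 1) == 0 by apply/eqP; rewrite -(subrr 1) -{3}ss; ring.
  rewrite mulf_eq0 => /orP[|/eqP s1]; last by rewrite -(addrK 1 s) s1 sub0r.
  rewrite subr_eq0 => /eqP s1; rewrite s1 !mul1r in rE qE pE.
  have K1 : L 1 0 0 0 *m K = L 0 a b c by rewrite -lin4_e.
  have K2 : L 0 1 0 0 *m K = L (- a) 0 p q by rewrite -lin4_eJ.
  have K3 : L 0 0 1 0 *m K = L (- b) (- p) 0 r by rewrite -lin4_f.
  have D3 := det_complex_frame_lin4 K1 K3.
  have D2 := det_complex_frame_lin4 K1 K2.
  have {}D3 : \det (complex_frame K (L 1 0 0 0) (L 0 0 1 0)) = (a * a + c * c) * dF.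
    by rewrite D3 rE pE; congr (_ * _); ring.
  have {}D2 : \det (complex_frame K (L 1 0 0 0) (L 0 1 0 0)) = (b * b + c * c) * dF.
    by rewrite D2 qE pE; congr (_ * _); ring.
  have pos (x : R) : 0 <= x -> dF * (x * dF) < 0 -> False.
    by move=> x0; rewrite mulrCA ltNge mulr_ge0// ltW.
  (* one of (e, Ke, f, Kf) and (e, Ke, Je, KJe) is a basis, since a, b, c do not
     all vanish, and its coordinate determinant is a sum of squares *)
  have [ac0|ac] := eqVneq (a * a + c * c) 0; last first.
    have [|] := pos (a * a + c * c); first by rewrite addr_ge0// -expr2 sqr_ge0.
    by rewrite -D3; apply: opp; rewrite ?D3 ?mulf_neq0.
  have bc : b * b + c * c != 0.
    have -> : b * b + c * c =
      0 * 0 + a * a + b * b + c * c - (a * a + c * c) + c ^+ 2 by ring.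
    by rewrite n1 ac0 subr0 gt_eqF// ltr_pwDl// sqr_ge0.
  have [|] := pos (b * b + c * c); first by rewrite addr_ge0// -expr2 sqr_ge0.
  by rewrite -D2; apply: opp; rewrite ?D2 ?mulf_neq0.
rewrite sN !mulN1r ?opprK in rE qE pE.
have EK x1 x2 x3 x4 : L x1 x2 x3 x4 *m K =
  L (- (x2 * a) - x3 * b - x4 * c) (x1 * a + x3 * c - x4 * b)
    (x1 * b - x2 * c + x4 * a) (x1 * c + x2 * b - x3 * a).
  rewrite {1}/lin4 !mulmxDl -!scalemxAl E1 E2 E3 E4 !lin4Z !lin4D rE qE pE.
  by congr lin4; ring.
apply: mulmx_ext => u; rewrite !mulmxA (fef u) !(EK, lin4_J JJ).
by congr lin4; ring.
Qed.

End Commute.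
End Frame.
End Quaternionic.

(** * The equivalence at a point *)

Local Notation gnorm := Defs.gnorm.

Section Pointwise.
Context (R : realType) (G J : 'M[R]_4).
Hypothesis (Gsym : G^T = G).
Hypothesis (Gpos : forall u : 'rV[R]_4, u != 0 -> 0 < inner G u u).
Hypothesis (JJ : J *m J = - 1%:M).
Hypothesis (Jorth : forall u v : 'rV[R]_4, inner G (u *m J) (v *m J) = inner G u v).
Context (Rm : 'rV[R]_4 -> 'rV[R]_4 -> 'rV[R]_4 -> 'rV[R]_4 -> R).
Hypothesis kRm : kaehler_tensor J Rm.
Implicit Types u v w : 'rV[R]_4.
Local Notation "<[ u , v ]>" := (inner G u v) (format "<[ u ,  v ]>").

Definition hol_depends_on (D : 'M[R]_4) : Prop := forall u v,
  gnorm G u = 1 -> gnorm G v = 1 ->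
  gnorm G (orthogonal_projection G D u) = gnorm G (orthogonal_projection G D v) ->
  Rm u (u *m J) (u *m J) u = Rm v (v *m J) (v *m J) v.

Lemma inner_ge0 u : 0 <= <[u, u]>.
Proof.
have [->|/Gpos/ltW//] := eqVneq u 0.
by rewrite /inner mul0mx mul0mx mxE.
Qed.

Lemma gnorm_eq u v : (gnorm G u = gnorm G v) <-> (<[u, u]> = <[v, v]>).
Proof.
split=> [E|E]; last by rewrite /gnorm E.
have := congr1 (fun x => x ^+ 2) E.
by rewrite /gnorm !sqr_sqrtr ?inner_ge0.
Qed.

Lemma gnorm_eq1 u : (gnorm G u = 1) <-> (<[u, u]> = 1).
Proof.
split=> [E|E]; last by rewrite /gnorm E sqrtr1.
by have := congr1 (fun x => x ^+ 2) E; rewrite /gnorm sqr_sqrtr ?inner_ge0// expr1n.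
Qed.

Section Adapted.
Context (D : 'M[R]_4) (e f : 'rV[R]_4).
Hypothesis (oef : orthonormal G J e f) (fef : unitary_frame G J e f).
Hypothesis projE : forall u,
  orthogonal_projection G D u = <[u, e]> *: e + <[u, e *m J]> *: (e *m J).
Local Notation L := (lin4 J e f).

Lemma proj_lin4 a b c d : orthogonal_projection G D (L a b c d) = L a b 0 0.
Proof.
rewrite projE; have [-> -> _ _] := coords_lin4 Gsym JJ Jorth oef a b c d.
by rewrite /lin4 !scale0r !addr0.
Qed.

(** In an adapted frame the norm of the projection is that of the first two
    coordinates. *)
Lemma hol_depends_onP : hol_depends_on D <-> circle_invariant J Rm e f.
Proof.
have O := inner_lin4 Gsym JJ Jorth oef.
split=> [H|cRm u v].
  apply: hol_circle_invariant => // x1 x2 x3 x4 y1 y2 y3 y4 x y xy; apply: H.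
  - by apply/gnorm_eq1; rewrite O -x; ring.
  - by apply/gnorm_eq1; rewrite O -y; ring.
  - apply/gnorm_eq; rewrite !proj_lin4 !O -!expr2 xy; ring.
rewrite (fef u) (fef v) !proj_lin4.
move=> /gnorm_eq1 + /gnorm_eq1 + /gnorm_eq; rewrite !O.
move: <[u, e]> <[u, e *m J]> <[u, f]> <[u, f *m J]> => x1 x2 x3 x4.
move: <[v, e]> <[v, e *m J]> <[v, f]> <[v, f *m J]> => y1 y2 y3 y4 x y xy.
rewrite !circle_invariant_hol//=.
have -> : x1 ^+ 2 + x2 ^+ 2 = y1 ^+ 2 + y2 ^+ 2.
  by rewrite !expr2; move: xy; rewrite !mul0r !addr0.
have -> // : x3 ^+ 2 + x4 ^+ 2 = y3 ^+ 2 + y4 ^+ 2.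
have -> : x3 ^+ 2 + x4 ^+ 2 =
  (x1 * x1 + x2 * x2 + x3 * x3 + x4 * x4) - (x1 * x1 + x2 * x2 + 0 * 0 + 0 * 0).
  by ring.
by rewrite x -y xy; ring.
Qed.
End Adapted.

(** J on D and - J on the orthogonal complement. *)
Definition reflected (D : 'M[R]_4) : 'M[R]_4 :=
  (2 *: proj_mx D (orthogonal_complement G D) - 1%:M) *m J.

Lemma mul_reflected (D : 'M[R]_4) u :
  u *m reflected D = (2 *: orthogonal_projection G D u - u) *m J.
Proof.
by rewrite /reflected mulmxA mulmxBr mulmx1 -scalemxAr.
Qed.

Lemma reflected_frame (D : 'M[R]_4) (e f : 'rV[R]_4) :
  (e <= D)%MS -> stablemx D J -> (f <= orthogonal_complement G D)%MS ->
  [/\ e *m reflected D = e *m J, e *m J *m reflected D = - e,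
      f *m reflected D = - (f *m J) & f *m J *m reflected D = f].
Proof.
move=> eD sD fD'; have sD' := stable_orthogonal Gsym JJ Jorth sD.
have PD u : (u <= D)%MS -> orthogonal_projection G D u = u.
  by move=> uD; apply: proj_unique => //; rewrite subrr sub0mx.
have PD' u : (u <= orthogonal_complement G D)%MS ->
    orthogonal_projection G D u = 0.
  by move=> uD; apply: proj_unique; rewrite ?sub0mx ?subr0.
have eJD : (e *m J <= D)%MS := submx_trans (submxMr J eD) sD.
have fJD' : (f *m J <= orthogonal_complement G D)%MS :=
  submx_trans (submxMr J fD') sD'.
have two u : 2 *: u - u = u by rewrite scaler_nat mulr2n addrK.
rewrite !mul_reflected (PD _ eD) (PD _ eJD) (PD' _ fD') (PD' _ fJD').
by rewrite !two scaler0 !sub0r !mulNmx !mulJJ// opprK.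
Qed.

Lemma reflected_spec (D : 'M[R]_4) : \rank D = 2 -> stablemx D J ->
  [/\ reflected D *m reflected D = - 1%:M,
      forall u v, <[u *m reflected D, v *m reflected D]> = <[u, v]>,
      opposite_orientation J (reflected D) &
      hol_depends_on D -> gray Rm (reflected D)].
Proof.
move=> rD sD.
have [e [f [oef fef eD fD' pE]]] := adapted_frame Gsym Gpos JJ Jorth rD sD.
have [Ke KeJ Kf KfJ] := reflected_frame eD sD fD'.
split; first exact: reflected_acs Ke KeJ Kf KfJ.
- exact: reflected_orthogonal Ke KeJ Kf KfJ.
- exact: (reflected_opposite Gsym JJ Jorth oef fef Ke KeJ Kf KfJ).
- move=> /(hol_depends_onP oef fef pE) cRm.
  exact: circle_invariant_gray Ke KeJ Kf KfJ fef cRm.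
Qed.

(** Any unit vector e spans a J-stable plane with Je. *)
Lemma exists_frame : exists e f, orthonormal G J e f /\ unitary_frame G J e f.
Proof.
have [|e _ e1] := normalized Gpos (D := 1%:M : 'M[R]_4).
  by rewrite -mxrank_eq0 mxrank1.
have sE : stablemx (col_mx e (e *m J)) J.
  rewrite mul_col_mx mulJJ// col_mx_sub eqmx_opp.
  by have := submx_refl (col_mx e (e *m J)); rewrite {1}col_mx_sub => /andP[-> ->].
have [||e' [f' [oef fef _ _ _]]] :=
  adapted_frame Gsym Gpos JJ Jorth (D := <<col_mx e (e *m J)>>%MS).
- by rewrite mxrank_gen (rank_col_mx_J Gsym JJ Jorth e1).
- by rewrite (eqmxMr _ (genmxE _)) genmxE.
by exists e', f'.
Qed.

Section Kernel.
Context (K : 'M[R]_4) (s : R).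
Hypothesis (KK : K *m K = - 1%:M).
Hypothesis (Korth : forall u v : 'rV[R]_4, inner G (u *m K) (v *m K) = inner G u v).
Hypothesis (opp : opposite_orientation J K).
Hypothesis (ss : s * s = 1).

Lemma negative_commute : K *m J = J *m K.
Proof.
have [e [f [oef fef]]] := exists_frame.
exact: (opposite_commute Gsym JJ Jorth oef fef KK Korth opp).
Qed.

Local Notation S := (K *m J).

Lemma commute_square : S *m S = 1%:M.
Proof.
by rewrite {2}negative_commute mulmxA -(mulmxA K) JJ mulmxN mulmx1 mulNmx KK opprK.
Qed.

Lemma square_factor t : t * t = 1 -> (S + t%:M) *m (S - t%:M) = 0.
Proof.
move=> tt; rewrite mulmxDl !mulmxBr commute_square -scalar_mxC -scalar_mxM tt.
by rewrite addrA addrNK subrr.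
Qed.

Lemma ker_stable t : stablemx (kermx (S - t%:M)) J.
Proof.
apply/sub_kermxP.
have -> : kermx (S - t%:M) *m J *m (S - t%:M) = kermx (S - t%:M) *m (S - t%:M) *m J.
  rewrite -!mulmxA; congr (_ *m _); rewrite mulmxBr mulmxBl scalar_mxC.
  by rewrite {1}negative_commute !mulmxA -negative_commute.
by rewrite mulmx_ker mul0mx.
Qed.

(** Otherwise K = J or K = - J, which has the orientation of J. *)
Lemma ker_neq0 t : t * t = 1 -> kermx (S - t%:M) != 0.
Proof.
move=> tt; apply/negP => /eqP k0.
have SE : S = - t%:M.
  apply/eqP; rewrite -subr_eq0 opprK -submx0 -k0; apply/eqP.
  by apply/eqP/sub_kermxP/square_factor.
have KE : K = t *: J.
  have : S *m J = - K by rewrite -mulmxA JJ mulmxN mulmx1.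
  by rewrite SE mulNmx mul_scalar_mx => /oppr_inj.
have [e [f [oef fef]]] := exists_frame.
have dF0 := frame_det_neq0 fef.
have D : \det (complex_frame K e f) = \det (complex_frame J e f).
  have Le : lin4 J e f 1 0 0 0 *m K = lin4 J e f 0 t 0 0.
    by rewrite KE -scalemxAr lin4_J// lin4Z oppr0 !mulr0 mulr1.
  have Lf : lin4 J e f 0 0 1 0 *m K = lin4 J e f 0 0 0 t.
    by rewrite KE -scalemxAr lin4_J// lin4Z oppr0 !mulr0 mulr1.
  have := det_complex_frame_lin4 Gsym JJ Jorth oef fef Le Lf.
  rewrite -(lin4_e J e f) -(lin4_f J e f) => ->.
  transitivity (t * t * \det (complex_frame J e f)); last by rewrite tt mul1r.
  by congr (_ * _); ring.
have := @opp e f e f dF0; rewrite D => /(_ dF0).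
by rewrite -expr2 ltNge sqr_ge0.
Qed.

Lemma ker_disjoint t : t * t = 1 ->
  (kermx (S - t%:M) :&: kermx (S - (- t)%:M))%MS = 0.
Proof.
move=> tt; apply/eqP/rowV0P => u; rewrite sub_capmx => /andP[].
move=> /sub_kermxP + /sub_kermxP.
rewrite !mulmxBr !mul_mx_scalar => /eqP; rewrite subr_eq0 => /eqP -> /eqP.
rewrite scaleNr opprK -scalerDl scaler_eq0 => /orP[|/eqP//].
rewrite -mulr2n mulrn_eq0/= => /eqP t0; move: tt; rewrite t0 mul0r => /eqP.
by rewrite eq_sym oner_eq0.
Qed.

(** The eigenspaces of KJ for t and - t are nonzero and J-stable, hence of
    dimension at least 2, and their sum is direct. *)
Lemma ker_rank t : t * t = 1 -> \rank (kermx (S - t%:M)) = 2.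
Proof.
move=> tt; have tt' : - t * - t = 1 by rewrite mulrNN.
have r1 := stable_rank_ge2 Gsym Gpos JJ Jorth (ker_stable t) (ker_neq0 tt).
have r2 := stable_rank_ge2 Gsym Gpos JJ Jorth (ker_stable (- t)) (ker_neq0 tt').
have := rank_leq_col (kermx (S - t%:M) + kermx (S - (- t)%:M))%MS.
rewrite mxrank_disjoint_sum; last exact: ker_disjoint.
move: r1 r2; move: (\rank _) (\rank _) => a b a2 b2 ab.
apply/eqP; rewrite eqn_leq a2 andbT -(leq_add2r a).
exact: leq_trans ab (leq_add (leqnn 2) b2).
Qed.

Lemma ker_mulK t u : (u <= kermx (S - t%:M))%MS -> u *m K = - t *: (u *m J).
Proof.
move=> /sub_kermxP; rewrite mulmxBr mul_mx_scalar => /eqP; rewrite subr_eq0 => /eqP E.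
have : u *m K *m J *m J = t *: (u *m J) by rewrite -(mulmxA u) E -scalemxAl.
by rewrite (mulJJ JJ) scaleNr => <-; rewrite opprK.
Qed.

(** Since KJ is self-adjoint and (KJ + s) maps into the eigenspace for s, the
    vector u (KJ + s) is both in that eigenspace and orthogonal to it. *)
Lemma ker_orthogonal u :
  (u <= orthogonal_complement G (kermx (S - s%:M)))%MS ->
  (u <= kermx (S - (- s)%:M))%MS.
Proof.
move=> uD'; have Sadj v w : <[v *m S, w]> = <[v, w *m S]>.
  rewrite mulmxA (J_skew JJ Jorth) (J_skew KK Korth) opprK.
  by rewrite -mulmxA -negative_commute.
apply/sub_kermxP; rewrite mulmxBr mul_mx_scalar scaleNr opprK.
apply: (inner_eq0 Gpos).
have xD : ((u *m S + s *: u)%R <= kermx (S - s%:M))%MS.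
  have -> : u *m S + s *: u = u *m (S + s%:M) by rewrite mulmxDr mul_mx_scalar.
  by apply/sub_kermxP; rewrite -mulmxA square_factor// mulmx0.
have /(sub_orthogonalP Gsym) uD := uD'.
have xS : (u *m S + s *: u) *m S = s *: (u *m S + s *: u).
  move/sub_kermxP: xD; rewrite mulmxBr mul_mx_scalar => /eqP.
  by rewrite subr_eq0 => /eqP.
by rewrite {1}innerDl Sadj innerZl xS innerZr !(uD _ xD) !mulr0 addr0.
Qed.

(** Rescaled by - s, K becomes the structure equal to J on the eigenspace and to
    - J on its complement. *)
Lemma kernel_hol : gray Rm K -> hol_depends_on (kermx (S - s%:M)).
Proof.
move=> gK; have sD := ker_stable s; have rD := ker_rank ss.
have [e [f [oef fef eD fD' pE]]] := adapted_frame Gsym Gpos JJ Jorth rD sD.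
have eK := ker_mulK eD; have fK := ker_mulK (ker_orthogonal fD').
rewrite opprK in fK.
have JK u : u *m J *m K = u *m K *m J by rewrite -!mulmxA negative_commute.
apply/(hol_depends_onP oef fef pE).
apply: (@gray_circle_invariant _ J _ kRm JJ e f (- s *: K)).
- by rewrite -scalemxAr eK scalerA mulrNN ss scale1r.
- by rewrite -scalemxAr JK eK -scalemxAl mulJJ// scalerA mulrNN ss scale1r.
- by rewrite -scalemxAr fK scalerA mulNr ss scaleN1r.
- by rewrite -scalemxAr JK fK -scalemxAl mulJJ// scalerA mulNr ss scaleN1r opprK.
by apply: (gray_scale kRm) => //; rewrite mulrNN.
Qed.

End Kernel.
End Pointwise.

(** * Distributions and almost complex structures on the surface *)

(** Four instances of the Bianchi identity are combined. *)
Lemma pair_symmetry (R : realType) (T : Type) (Q : T -> T -> T -> T -> R) :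
  (forall u v w z, Q u v w z = - Q v u w z) ->
  (forall u v w z, Q u v w z = - Q u v z w) ->
  (forall u v w z, Q u v w z + Q v w u z + Q w u v z = 0) ->
  forall u v w z, Q u v w z = Q w z u v.
Proof.
move=> A12 A34 B u v w z.
have b1 := B u v w z; have b2 := B v w z u.
have b3 := B w z u v; have b4 := B z u v w.
rewrite (A34 v w z u) (A34 w z v u) (A12 z v w u) in b2.
rewrite (A12 z u w v) (A34 u z w v) (A34 u w z v) (A12 u w v z) in b3.
rewrite (A12 z u v w) (A34 u v z w) (A34 v z u w) in b4.
move: b1 b2 b3 b4; move: (Q u v w z) (Q w z u v) (Q v w u z) (Q w u v z).
move: (Q v z w u) (Q u z v w) => c' b' a a' b c b1 b2 b3 b4.
lra.
Qed.

Lemma Riem_kaehler (R : realType) (G J : 'rV[R]_4 -> 'M[R]_4) (U : set 'rV[R]_4)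
    (y : 'rV[R]_4) :
  open U -> smooth_on U G -> (forall z, U z -> (G z)^T = G z) ->
  (forall z, U z -> G z \in unitmx) -> smooth_on U J ->
  (forall u v, inner (G y) (u *m J y) (v *m J y) = inner (G y) u v) ->
  (forall z u, U z ->
     'D_u J z = christoffel_mx G z u *m J z - J z *m christoffel_mx G z u) ->
  U y -> kaehler_tensor (J y) (Riem G y).
Proof.
move=> oU smG Gsym Gu smJ Jorth parJ Uy.
have E u v w z : Riem G y u v w z = inner (G y) (w *m curvature_mx G y u v) z.
  by rewrite /Riem (curvatureE oU smG Gsym Gu).
have Gy := Gsym _ Uy.
have A12 u v w z : Riem G y u v w z = - Riem G y v u w z.
  by rewrite !E curvature_mx_anti mulmxN innerNl.
have A34 u v w z : Riem G y u v w z = - Riem G y u v z w.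
  rewrite !E (inner_sym _ w Gy) /inner -(mulmxA w).
  rewrite (curvature_mx_skew oU smG Gsym Gu)// mulmxN mulNmx mxE trmx_mul.
  by rewrite !mulmxA.
have B u v w z : Riem G y u v w z + Riem G y v w u z + Riem G y w u v z = 0.
  rewrite !E -!innerDl (curvature_mx_bianchi oU smG Gsym Gu)//.
  by rewrite /inner !mul0mx mxE.
have S := pair_symmetry A12 A34 B.
have J34 u v w z : Riem G y u v (w *m J y) (z *m J y) = Riem G y u v w z.
  rewrite !E -mulmxA -(curvature_mx_parallel oU smG Gu smJ parJ)//.
  by rewrite mulmxA Jorth.
split; [|exact: A12|exact: S|by move=> u v w z; rewrite S J34 S].
move=> a u u' v w z; rewrite !(S _ v w z) !E mulmxDl -scalemxAl.
by rewrite innerDl innerZl.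
Qed.

(** The Gram matrix E G E^T of the frame E is invertible, and the projection is
    given by a formula that depends smoothly on E and G. *)
Lemma proj_frame (R : realType) (n k : nat) (G D : 'M[R]_n) (E : 'M[R]_(k, n)) :
  G^T = G -> (forall u : 'rV[R]_n, u != 0 -> 0 < inner G u u) ->
  (E == D)%MS -> \rank D = k ->
  E *m G *m E^T \in unitmx /\
  proj_mx D (orthogonal_complement G D) =
  G *m E^T *m invmx (E *m G *m E^T) *m E.
Proof.
move=> Gsym Gpos ED rD.
have Efree : row_free E by rewrite /row_free (eqmxP ED) rD.
have Gram : E *m G *m E^T \in unitmx.
  rewrite -row_free_unit -kermx_eq0; apply/negPn/negP => /rowV0Pn[w].
  move=> /sub_kermxP wG w0.
  have wE0 : w *m E != 0 by rewrite mulmx_free_eq0.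
  have := Gpos _ wE0; rewrite /inner trmx_mul !mulmxA.
  have -> : w *m E *m G *m E^T = w *m (E *m G *m E^T) by rewrite !mulmxA.
  by rewrite wG mul0mx mxE ltxx.
split=> //; apply: mulmx_ext => u; apply: proj_unique => //.
  by rewrite !mulmxA -(eqmxP ED) submxMl.
apply/sub_orthogonalP => // d; rewrite -(eqmxP ED) => /submxP[w ->].
rewrite /inner mulmxBl mulmxBl trmx_mul.
have -> : u *m (G *m E^T *m invmx (E *m G *m E^T) *m E) *m G *m (E^T *m w^T) =
    u *m G *m (E^T *m w^T); last by rewrite subrr mxE.
transitivity (u *m (G *m E^T) *m (invmx (E *m G *m E^T) *m (E *m G *m E^T)) *m w^T).
  by move: (invmx _) => P; rewrite !mulmxA.
by rewrite mulVmx// mulmx1 !mulmxA.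
Qed.

Section Manifold.
Context (R : realType) (M : manifold R 4).
Implicit Types (g J K D : components M) (c d : Defs.index M).
Local Notation O c := (chart_codom (atlas c)).

Lemma chart_codom_open c : open (O c).
Proof. exact: codom_open. Qed.

Lemma overlap_codom c d y : overlap (atlas c) (atlas d) y ->
  O c y /\ O d (transition (atlas c) (atlas d) y).
Proof.
move=> [x [cx dx] <-]; split; first by exists x.
by rewrite /transition /= coordK//; exists x.
Qed.

Lemma metric_unit_at g c y : riemannian_metric g -> O c y -> g c y \in unitmx.
Proof. by move=> [_ _ gs gp] Oy; apply: metric_unit => u; exact: gp. Qed.

(** The transformation rule of the metric exhibits an invertible matrix as a
    product having the Jacobian as a factor. *)
Lemma jacobian_unit g c d y : riemannian_metric g ->
  overlap (atlas c) (atlas d) y ->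
  'J (transition (atlas c) (atlas d)) y \in unitmx.
Proof.
move=> gm ov; have [Oc Od] := overlap_codom ov.
have := metric_unit_at gm Oc; have [_ gf _ _] := gm.
by rewrite (gf _ _ _ ov) /= unitmx_mul unitmx_mul => /andP[/andP[]].
Qed.

Lemma kahler_tensor_at g J c y : kahler g J -> O c y ->
  kaehler_tensor (J c y) (Riem (g c) y).
Proof.
move=> [gm [smJ _ JJ Jo] par] Oy; have [smg _ gs gp] := gm.
have oO := @chart_codom_open c.
apply: (Riem_kaehler oO (smg c) (gs c) _ (smJ c)) => //.
- by move=> z; exact: metric_unit_at.
- by move=> u v; exact: Jo.
- move=> z u Oz; apply: mulmx_ext => w.
  have smc (a : 'rV[R]_4) : smooth_on (O c) (cst a) by move=> k; exact: Ck_cst.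
  have := par c z (cst u) (cst w) Oz (smc u) (smc w).
  rewrite /nabla /= derive_cst add0r !(christoffelE (smg c))//.
  have -> : 'D_u (fun z => w *m J c z) z = w *m 'D_u (J c) z.
    by apply: derive_mulmxr; exact: Ck_derivable Oz (smJ c 1).
  by rewrite mulmxBr !mulmxA => <-; rewrite addrK.
Qed.

Section FromDistribution.
Context (g J D : components M).
Hypothesis gJ : kahler g J.
Hypothesis (sD : smooth_distribution 2 D) (iD : invariant_distribution J D).

Let gm : riemannian_metric g. Proof. by case: gJ. Qed.
Let gs c y (Oy : O c y) : (g c y)^T = g c y. Proof. by case: gm => _ _ + _; apply. Qed.
Let gp c y (Oy : O c y) u : u != 0 -> 0 < inner (g c y) u u.
Proof. by case: gm => _ _ _; apply. Qed.

Definition reflected_components : components M :=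
  fun c y => reflected (g c y) (J c y) (D c y).

Lemma reflected_smooth : smooth_components reflected_components.
Proof.
move=> c k; apply: Ck_local => y Oy.
case: sD => _ rD /(_ c y Oy)[U [E [oU Uy UO smE ED]]].
exists U => //.
have [[smg _ _ _] [smJ _ _ _]] : riemannian_metric g /\ orthogonal_acs g J by case: gJ.
have cg : Ck k U (g c) by exact: Ck_subset UO (smg c k).
have cJ : Ck k U (J c) by exact: Ck_subset UO (smJ c k).
have cE := smE k; have cET := Ck_trmx oU cE.
have F z (Uz : U z) := proj_frame (gs (UO z Uz)) (@gp c z (UO z Uz)) (ED z Uz)
  (rD c z (UO z Uz)).
pose P z := g c z *m (E z)^T *m invmx (E z *m g c z *m (E z)^T) *m E z.
apply: (@Ck_eq _ _ _ _ _ (fun z => (2%:M *m P z + (- 1%:M)) *m J c z)) => //.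
  by move=> z Uz; rewrite /reflected_components /reflected (F z Uz).2 mul_scalar_mx.
apply: Ck_mulmx => //; apply: Ck_add => //; last exact: Ck_cst.
apply: Ck_mulmx => //; first exact: Ck_cst.
apply: Ck_mulmx => //; apply: Ck_mulmx => //; first exact: Ck_mulmx.
apply: Ck_invmx => // [z Uz|]; first exact: (F z Uz).1.
by apply: Ck_mulmx => //; exact: Ck_mulmx.
Qed.

(** The Jacobian maps D to D and is isometric, so it intertwines the orthogonal
    projections. *)
Lemma reflected_endomorphism : is_endomorphism reflected_components.
Proof.
move=> c d y ov /=; have [Oc Od] := overlap_codom ov.
have Au := jacobian_unit gm ov.
have gE : is_form g by case: gm. have {gE} := gE c d y ov.
have [_ [_ JE _ _] _] := gJ; have {JE} := JE c d y ov.
have [DE _ _] := sD; have {DE} := DE c d y ov.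
rewrite /= /reflected_components /reflected.
move: ('J _ _) Au (transition _ _ y) Od => A Au y' Od /eqmxP DE JE GE.
have PA : proj_mx (D c y) (orthogonal_complement (g c y) (D c y)) *m A =
    A *m proj_mx (D d y') (orthogonal_complement (g d y') (D d y')).
  apply: mulmx_ext => u; rewrite [LHS]mulmxA [RHS]mulmxA; apply/esym.
  apply: (proj_unique (gs Od) (@gp _ _ Od)).
    by rewrite -DE; apply: submxMr; exact: proj_mx_sub.
  apply/(sub_orthogonalP (gs Od)) => x; rewrite -DE => /submxP[w ->].
  rewrite -mulmxBl; set v := u - _.
  have := proj_compl_sub (gs Oc) (@gp _ _ Oc) (D c y) u.
  move=> /(sub_orthogonalP (gs Oc))/(_ (w *m D c y) (submxMl _ _)).
  rewrite -/v /inner GE => <-.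
  by rewrite mulmxA trmx_mul !mulmxA.
move: (proj_mx _ _) (proj_mx (D d y') _) PA => P P' PA.
by rewrite -mulmxA JE !mulmxA mulmxBl mulmxBr mul1mx mulmx1 -scalemxAl PA scalemxAr.
Qed.

Lemma reflected_negative_gray :
  (forall c y (u v : 'rV[R]_4), O c y ->
     Defs.gnorm (g c y) u = 1 -> Defs.gnorm (g c y) v = 1 ->
     Defs.gnorm (g c y) (orthogonal_projection (g c y) (D c y) u) =
     Defs.gnorm (g c y) (orthogonal_projection (g c y) (D c y) v) ->
     holomorphic_curvature g J c y u = holomorphic_curvature g J c y v) ->
  negative_acs g J reflected_components /\
  second_gray_condition g reflected_components.
Proof.
move=> hol; have [_ [_ _ JJ Jo] _] := gJ; have [_ rD _] := sD.
have S c y (Oy : O c y) := reflected_spec (gs Oy) (@gp c y Oy) (JJ c y Oy)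
  (fun u v => Jo c y u v Oy) (kahler_tensor_at gJ Oy) (rD c y Oy) (iD Oy).
split; last first.
  move=> c y X Y Z W Oy; have [_ _ _ gr] := S c y Oy; apply: gr.
  by move=> u v; exact: hol.
split; last by move=> c y Oy; have [] := S c y Oy.
split; [exact: reflected_smooth|exact: reflected_endomorphism| |].
  by move=> c y Oy; have [] := S c y Oy.
by move=> c y u v Oy; have [_ + _ _] := S c y Oy; apply.
Qed.
End FromDistribution.

Section FromStructure.
Context (g J K : components M).
Hypothesis gJ : kahler g J.
Hypothesis (nK : negative_acs g J K) (gK : second_gray_condition g K).
Context (s : R).
Hypothesis (ss : s * s = 1).

Let gm : riemannian_metric g. Proof. by case: gJ. Qed.
Let gs c y (Oy : O c y) : (g c y)^T = g c y. Proof. by case: gm => _ _ + _; apply. Qed.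
Let gp c y (Oy : O c y) u : u != 0 -> 0 < inner (g c y) u u.
Proof. by case: gm => _ _ _; apply. Qed.
Let JJ c y (Oy : O c y) : J c y *m J c y = - 1%:M.
Proof. by have [_ [_ _ + _] _] := gJ; apply. Qed.
Let Jo c y (Oy : O c y) u v :
  inner (g c y) (u *m J c y) (v *m J c y) = inner (g c y) u v.
Proof. by have [_ [_ _ _ +] _] := gJ; apply. Qed.
Let KK c y (Oy : O c y) : K c y *m K c y = - 1%:M.
Proof. by have [[_ _ + _] _] := nK; apply. Qed.
Let Ko c y (Oy : O c y) u v :
  inner (g c y) (u *m K c y) (v *m K c y) = inner (g c y) u v.
Proof. by have [[_ _ _ +] _] := nK; apply. Qed.
Let opp c y (Oy : O c y) : opposite_orientation (J c y) (K c y).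
Proof. by have [_ +] := nK; apply. Qed.

(** With s = 1 and s = - 1, the two kernels of the statement. *)
Definition ker_components : components M :=
  fun c y => kermx (K c y *m J c y - s%:M).

Let rk c y (Oy : O c y) : \rank (ker_components c y) = 2.
Proof.
exact (ker_rank (gs Oy) (@gp _ _ Oy) (JJ Oy) (@Jo _ _ Oy) (KK Oy) (@Ko _ _ Oy)
  (@opp _ _ Oy) ss).
Qed.

Let stab c y (Oy : O c y) : stablemx (ker_components c y) (J c y).
Proof.
exact (ker_stable (gs Oy) (@gp _ _ Oy) (JJ Oy) (@Jo _ _ Oy) (KK Oy) (@Ko _ _ Oy)
  (@opp _ _ Oy) s).
Qed.

Lemma ker_subbundle : is_subbundle ker_components.
Proof.
move=> c d y ov /=; have [Oc Od] := overlap_codom ov.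
have Au := jacobian_unit gm ov; have rc := rk Oc; have rd := rk Od.
have [_ [_ JE _ _] _] := gJ; have {JE} := JE c d y ov.
have [[_ KE _ _] _] := nK; have {KE} := KE c d y ov.
move: rd; rewrite /= /ker_components.
move: ('J _ _) Au (transition _ _ y) Od => A Au y' Od rd KE JE.
apply/eqmxP; apply: eqmx_trans (eqmx_refl _).
have sub : (kermx (K c y *m J c y - s%:M) *m A <=
            kermx (K d y' *m J d y' - s%:M))%MS.
  apply/sub_kermxP; rewrite -mulmxA.
  have -> : A *m (K d y' *m J d y' - s%:M) = (K c y *m J c y - s%:M) *m A.
    by rewrite mulmxBr mulmxBl scalar_mxC mulmxA -KE -!mulmxA JE.
  by rewrite mulmxA mulmx_ker mul0mx.
apply/eqmxP; rewrite sub /= -(mxrank_leqif_sup sub).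
by rewrite rd mxrankMfree ?row_free_unit// rc.
Qed.

(** A basis B of the eigenspace at y is mapped by KJ + s into the eigenspace at
    every point, because (KJ + s)(KJ - s) = 0. At y the images are 2 s B, so they
    are independent at y and therefore nearby, where their Gram determinant for
    the inner product of y does not vanish. *)
Lemma ker_local_frame c y : O c y ->
  exists (U : set 'rV[R]_4) (E : 'rV[R]_4 -> 'M[R]_(2, 4)),
    [/\ open U, U y, U `<=` O c, smooth_on U E &
        forall z, U z -> (E z == ker_components c z)%MS].
Proof.
move=> Oy; have oO := @chart_codom_open c.
pose S z := K c z *m J c z.
have [B Bk rB] : exists2 B : 'M[R]_(2, 4), (B <= ker_components c y)%MS & \rank B = 2.
  have [|e eD e1] := normalized (@gp _ _ Oy) (D := ker_components c y).
    by rewrite -mxrank_eq0 rk.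
  exists (col_mx e (e *m J c y)); first exact: stable_col_mx_J (stab Oy) eD.
  exact: rank_col_mx_J (gs Oy) (JJ Oy) (@Jo _ _ Oy) _ e1.
pose E z := B *m (S z + s%:M).
pose h z := \det (E z *m g c y *m (E z)^T).
have cE k : Ck k (O c) E.
  have [[smK _ _ _] _] := nK; have [_ [smJ _ _ _] _] := gJ.
  apply: Ck_mulmx => //; first exact: Ck_cst.
  apply: Ck_add => //; last exact: Ck_cst.
  by apply: Ck_mulmx; [|exact: smK|exact: smJ].
have ch : Ck 0 (O c) h.
  have cEG := Ck_mulmx oO (cE 0) (@Ck_cst _ _ _ 0 (O c) (g c y)).
  exact: Ck_det oO (Ck_mulmx oO cEG (Ck_trmx oO (cE 0))).
have hy : h y != 0.
  have EB : E y = (s + s) *: B.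
    rewrite /E mulmxDr mul_mx_scalar scalerDl; congr (_ + _).
    move/sub_kermxP: Bk; rewrite mulmxBr mul_mx_scalar => /eqP.
    by rewrite subr_eq0 => /eqP.
  have sn : s + s != 0.
    rewrite -mulr2n mulrn_eq0 /=; apply/eqP => s0; move: ss; rewrite s0 mul0r.
    by move=> /eqP; rewrite eq_sym oner_eq0.
  have rE : \rank (E y) = 2 by rewrite EB mxrank_scale_nz.
  have [+ _] := proj_frame (gs Oy) (@gp _ _ Oy) (k := 2) (E := E y) (D := <<E y>>%MS)
    (introT eqmxP (eqmx_sym (genmxE _))) (etrans (mxrank_gen _) rE).
  by rewrite unitmxE unitfE.
exists [set z | O c z /\ h z != 0], E; split => //.
- rewrite openE => z [Oz hz]; rewrite /interior.
  have nO : \forall x \near z, O c x := open_nbhs_nbhs (conj oO Oz).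
  have nh : \forall x \near z, h x != 0 by exact: (cvgr_neq0 (h z) (ch z Oz) hz).
  by apply: filterS2 nO nh => x.
- by move=> z [].
- by move=> k; apply: Ck_subset (cE k) => z [].
move=> z [Oz hz].
have sub : (E z <= ker_components c z)%MS.
  apply/sub_kermxP; rewrite -mulmxA.
  by rewrite (square_factor (gs Oz) (@gp _ _ Oz) (JJ Oz) (@Jo _ _ Oz) (KK Oz)
    (@Ko _ _ Oz) (@opp _ _ Oz) ss) mulmx0.
rewrite sub /= -(mxrank_leqif_sup sub) rk// eqn_leq rank_leq_row /=.
have : E z *m g c y *m (E z)^T \in unitmx by rewrite unitmxE unitfE.
move=> /mxrank_unit rG; rewrite -[X in (X <= _)%N]rG -mulmxA.
exact: mxrankM_maxl.
Qed.

Lemma ker_QCH : QCH_wrt g J ker_components.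
Proof.
split; [split; [exact: ker_subbundle|exact: rk|exact: ker_local_frame]|exact: stab|].
move=> c y u v Oy; apply: (kernel_hol (gs Oy) (@gp _ _ Oy) (JJ Oy) (@Jo _ _ Oy)
  (kahler_tensor_at gJ Oy) (KK Oy) (@Ko _ _ Oy) (@opp _ _ Oy) ss).
by move=> X Y Z W; exact: gK.
Qed.

End FromStructure.
End Manifold.

Theorem mainTheorem3 (R : realType) (M : manifold R 4) (g J : components M)
    (M_connected : connected [set: M]) (gJ_kahler : kahler g J) :
  (QCH g J <->
     exists K : components M, negative_acs g J K /\ second_gray_condition g K)
  /\
  (forall K : components M, negative_acs g J K -> second_gray_condition g K ->
     QCH_wrt g J (ker_sub J K) /\ QCH_wrt g J (ker_add J K)).
Proof.
have kernels K : negative_acs g J K -> second_gray_condition g K ->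
    QCH_wrt g J (ker_sub J K) /\ QCH_wrt g J (ker_add J K).
  move=> nK gK; split; first exact: (ker_QCH gJ_kahler nK gK (mulr1 1)).
  have -> : ker_add J K = ker_components J K (-1).
    apply/funext => c; apply/funext => y.
    by rewrite /ker_add /ker_components raddfN opprK.
  by apply: (ker_QCH gJ_kahler nK gK); rewrite mulrNN mulr1.
split=> //; split=> [[D [sD iD hD]]|[K [nK gK]]].
  by exists (reflected_components g J D); exact: reflected_negative_gray.
by exists (ker_sub J K); have [] := kernels K nK gK.
Qed.
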